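(* Let $\mathbb A=[I_\alpha,I_\beta]\times\mathbb T^1$, $\mathbb T^1=\mathbb R/\mathbb Z$, and let $\sigma_\epsilon$ (for $\epsilon\ge0$ small) be a scattering map, expressed in action-angle coordinates $(I,\theta)$, associated to a channel $\Gamma$, $\sigma_\epsilon:\Omega^-(\Gamma)\to\Omega^+(\Gamma)$. Assume: 1. $\Omega^-(\Gamma)\cap\mathbb A=\mathbb A\setminus\mathcal C$, where $\mathcal C$ is a $C^1$-curve running from the lower boundary to the upper boundary of the annulus, i.e. the graph of a $C^1$ function $I\in[I_\alpha,I_\beta]\mapsto\mathcal C(I)\in\mathbb A$ with $\mathcal C(I_\alpha)\in\{I_\alpha\}\times\mathbb T^1$ and $\mathcal C(I_\beta)\in\{I_\beta\}\times\mathbb T^1$. 2. For $(I,\theta)\in\mathbb A\setminus\mathcal C$, $$\sigma_\epsilon(I,\theta)=(I,\theta+\Delta(I))+\epsilon\left(-\frac{\partial S}{\partial\theta},\frac{\partial S}{\partial I}\right)(I,\theta+\Delta(I))+O(\epsilon^2).$$ 3. With $\mu=dI\wedge d\theta$ the Liouville measure on $\mathbb A$, $$\int_{\mathbb A}\left[-\frac{\partial S}{\partial\theta}(I,\theta+\Delta(I))\right]d\mu\neq0.$$ Then there exist $\epsilon_0>0$ and $C>0$ such that for each $0<\epsilon<\epsilon_0$ there exists a (pseudo-)orbit $(I_n,\theta_n)$, $n=0,\dots,N$, of $\sigma_\epsilon$ such that $$|I_N-I_0|>C>0.$$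
   Context: For a normally hyperbolic invariant manifold (NHIM) $\Lambda$, $\Omega^\pm$ are the wave maps sending a point of $W^s(\Lambda)$ (resp. $W^u(\Lambda)$) to the base point in $\Lambda$ of its stable (resp. unstable) fiber; a channel $\Gamma$ is a submanifold of a transverse intersection of stable and unstable manifolds on which $\Omega^\pm$ are diffeomorphisms onto their images; the scattering map is $\Omega^+|_\Gamma\circ(\Omega^-|_\Gamma)^{-1}$. The (two-dimensional, perturbed) NHIM $\Lambda_\epsilon$ is identified with a neighborhood of $\mathbb A$ in $\mathbb R\times\mathbb T^1$ with coordinates $(I,\theta)$, and $\sigma_\epsilon$ with its coordinate expression. For the purposes of the claim only the following is used about $\sigma_\epsilon$: it is a map defined on $\mathbb A\setminus\mathcal C$ with values in a neighborhood of $\mathbb A$ in $\mathbb R\times\mathbb T^1$, it is a diffeomorphism onto its image, and it is symplectic (preserves $dI\wedge d\theta$). It depends smoothly on the variables and on $\epsilon$, and, as a consequence, there are constants $M,C_0>0$ with $\|S\|_{C^1}\le M$ (where $S=S(I,\theta)$ is independent of $\epsilon$ and defined almost everywhere on $\mathbb A$, namely where $(I,\theta)=(I,\theta'+\Delta(I))$ with $(I,\theta')\in\mathbb A\setminus\mathcal C$), and the $O(\epsilon^2)$ error term in condition 2 is bounded by $C_0\epsilon^2$ uniformly in $(I,\theta)\in\mathbb A\setminus\mathcal C$. The integral in condition 3 is in the sense of Lebesgue. A (pseudo-)orbit of $\sigma_\epsilon$ is a finite sequence with $(I_{n+1},\theta_{n+1})=\sigma_\epsilon(I_n,\theta_n)$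 for $0\le n<N$, each $(I_n,\theta_n)$, $n<N$, lying in the domain of $\sigma_\epsilon$. *)

(* Defs.v *)
From HB Require Import structures.
From mathcomp Require Import all_boot all_order all_algebra.
From mathcomp Require Import generic_quotient ring_quotient.
From mathcomp Require Import all_classical all_reals all_analysis.
Import Order.TTheory GRing.Theory Num.Theory.
Import numFieldNormedType.Exports.

Set Implicit Arguments.
Unset Strict Implicit.
Unset Printing Implicit Defensive.

Local Open Scope classical_set_scope.
Local Open Scope ring_scope.

Definition circle (R : realType) : zmodType :=
  Quotient.quot (GRing.ZmodClosed.clone R (@Num.int_num_subdef R) _).

Definition ang (R : realType) (x : R) : circle R := \pi_(circle R)%qT x.

Definition cylinder (R : realType) : zmodType := (R * circle R)%type.

(* Tangent vectors of the cylinder, in the coordinates (I, theta). *)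
Definition vec (R : realType) (a b : R) : 'cV[R]_2 :=
  \col_(i < 2) (if i == 0 then a else b).

(* The covering map R^2 -> R x R/Z. The maps h |-> z + cov h, for h near 0, are
   the charts of the cylinder around z, and all differential notions below are
   expressed in these charts. Two such charts differ by a translation, so
   derivatives do not depend on the choice made. *)
Definition cov (R : realType) (h : 'cV[R]_2) : cylinder R :=
  (h 0 0, ang (h 1 0)).

(* The subsets D used are the annulus minus a curve and its diffeomorphic
  images, which have boundary points; derivatives are therefore taken along D
  (at a boundary point they are one-sided). *)

Section Calculus.
Variable R : realType.
Implicit Types (D : set (cylinder R)) (z : cylinder R).

Definition continuous_along (T : topologicalType) D (F : cylinder R -> T) :=
  forall z, D z ->
    F (z + cov h) @[h --> within [set h | D (z + cov h)] (nbhs (0 : 'cV[R]_2))]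
      --> F z.

(* S is C^1 on D with partial derivatives dIS = dS/dI and dthS = dS/dtheta. *)
Definition C1_fun D (S dIS dthS : cylinder R -> R) :=
  [/\ forall z, D z -> forall e : R, 0 < e ->
        \forall h \near (0 : 'cV[R]_2), D (z + cov h) ->
          `|S (z + cov h) - S z - (dIS z * h 0 0 + dthS z * h 1 0)|
            <= e * `|h|,
      continuous_along D dIS & continuous_along D dthS].

(* f is C^1 on D with derivative Df; k is the increment of f, read in the chart
   at f z. *)
Definition C1_map D (f : cylinder R -> cylinder R)
    (Df : cylinder R -> 'M[R]_2) :=
  (forall z, D z -> forall e : R, 0 < e ->
     \forall h \near (0 : 'cV[R]_2), D (z + cov h) ->
       exists2 k : 'cV[R]_2, f (z + cov h) = f z + cov k
                           & `|k - Df z *m h| <= e * `|h|)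
  /\ continuous_along D Df.

Definition diffeo_onto_image D (f : cylinder R -> cylinder R) :=
  exists Df g Dg,
    [/\ C1_map D f Df, C1_map (f @` D) g Dg & forall z, D z -> g (f z) = z].

(* The 2-form dI /\ dtheta. *)
Definition area_form (u v : 'cV[R]_2) : R := u 0 0 * v 1 0 - u 1 0 * v 0 0.

Definition symplectic D (f : cylinder R -> cylinder R) :=
  exists2 Df, C1_map D f Df &
    forall z, D z ->
      forall u v, area_form (Df z *m u) (Df z *m v) = area_form u v.

Definition C1_angle (a b : R) (c : R -> circle R) :=
  exists2 dc : R -> R, {within `[a, b], continuous dc} &
    forall x, x \in `[a, b] -> forall e : R, 0 < e ->
      \forall h \near (0 : R), x + h \in `[a, b] ->
        exists2 k : R, c (x + h) = c x + ang k & `|k - dc x * h| <= e * `|h|.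

Definition annulus (a b : R) : set (cylinder R) := [set z | z.1 \in `[a, b]].

(* The graph of c : [a, b] -> R/Z, i.e. the curve I |-> (I, c I), whose end
   points are on the two boundary circles of the annulus. *)
Definition curve (a b : R) (c : R -> circle R) : set (cylinder R) :=
  [set z | z.1 \in `[a, b] /\ z.2 = c z.1].

(* Integral over D for dI /\ dtheta, computed in the fundamental domain
   R x [0, 1) of the covering R x R -> R x R/Z. An integrand defined only almost
   everywhere on the annulus is integrated over its domain D, the removed curve
   being a null set. *)
Definition liouville_integral D (F : cylinder R -> R) : \bar R :=
  let lift (p : R * R) : cylinder R := (p.1, ang p.2) in
  let D0 : set (R * R) := [set p | 0 <= p.2 < 1 /\ D (lift p)] in
  (\int[(lebesgue_measure \x lebesgue_measure)%E]_(p in D0)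
     (F (lift p))%:E)%E.

Definition orbit_on D (f : cylinder R -> cylinder R) (N : nat)
    (z : nat -> cylinder R) :=
  forall n, (n < N)%N -> D (z n) /\ z n.+1 = f (z n).

Definition base_rotation (Delta : R -> R) (z : cylinder R) : cylinder R :=
  (z.1, z.2 + ang (Delta z.1)).

End Calculus.

(* Main.v *)
(* If no orbit moved the action by more than C, the orbits of the points with
   action in [Ia + C, Ib - C] would stay in the annulus, hence be defined for all
   times outside a null set: sigma_eps preserves area, so the points that hit the
   curve form a null set. The set U of the points with an infinite orbit would then
   miss at most 2 C of the area; it is mapped into itself by an area-preserving
   map, so the displacement of the action has zero mean on U. Dividing by eps, the
   integral in the third hypothesis is at most O(eps) + 2 M C, which is a
   contradiction for small eps and C.

   Area preservation is only needed in the form area (f^-1 B) <= area B. For this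
   f^-1 B is cut into countably many pieces on which f is within a relative error
   of a unimodular linear map L. If F is f read in the plane, L is then Lipschitz
   with constant close to 1 in terms of F, so that the preimage of a dyadic square
   of side s is contained in the L-preimage of a square of side K s; the monotone
   class theorem extends the inequality from dyadic squares to Borel sets. The
   pieces are closed up in the target, by continuity of the inverse of f, so that
   they correspond to Borel sets. *)

Require Import Defs.
From HB Require Import structures.
From mathcomp Require Import all_boot all_order all_algebra.
From mathcomp Require Import generic_quotient ring_quotient.
From mathcomp Require Import all_classical all_reals all_analysis.
From mathcomp Require Import measurable_realfun ring lra.
Import Order.TTheory GRing.Theory Num.Theory.
Import numFieldNormedType.Exports.

Set Implicit Arguments.
Unset Strict Implicit.
Unset Printing Implicit Defensive.

Local Open Scope classical_set_scope.
Local Open Scope ring_scope.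

(* [lebesgue_measure] lives on [measurableTypeR R], whose display differs from
   that of the Borel structure of [R]. *)
Notation plane R := (measurableTypeR R * measurableTypeR R)%type.

Definition leb2 (R : realType) : set (plane R) -> \bar R :=
  (lebesgue_measure \x lebesgue_measure)%E.

HB.instance Definition _ (R : realType) := Measure.on (@leb2 R).

(** The pushforward as a bundled measure known only through its values, the form in which uniqueness
    and domination of measures are applied to it. *)
Lemma pushforward_measure_exists d d' (T : measurableType d)
    (T' : measurableType d') (R : realFieldType)
    (m : {measure set T -> \bar R}) (f : T -> T') :
  measurable_fun [set: T] f ->
  exists nu : {measure set T' -> \bar R}, forall A, nu A = m (f @^-1` A).
Proof.
move=> mf.
pose nu : {measure set T' -> \bar R} :=
  measure_function_pushforward__canonical__measure_function_Measure m mf.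
by exists nu.
Qed.

(** * Area in the plane *)

Section plane_measure.
Variable R : realType.
Local Notation mu := (@leb2 R).
Local Notation leb := (@lebesgue_measure R).

(** The pushforward by the translation gives half-open intervals their length, so it is Lebesgue
    measure by uniqueness. *)
Lemma lebesgue_measure_shift (t : R) (A : set (measurableTypeR R)) :
  measurable A -> leb ((fun y => y + t : measurableTypeR R) @^-1` A) = leb A.
Proof.
move=> mA; pose f (y : measurableTypeR R) : measurableTypeR R := y + t.
have mf : measurable_fun [set: measurableTypeR R] f.
  exact: (@measurable_funD _ (measurableTypeR R)).
have [nu nuE] := pushforward_measure_exists leb mf.
rewrite -[LHS](nuE A); apply/esym/(@lebesgue_measure_unique R nu) => //.
move=> _ [[a b] _ <-]; rewrite nuE.
have -> : f @^-1` `]a, b]%classic = `]a - t, b - t]%classic.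
  by apply/seteqP; split=> y; rewrite /f /= !in_itv/= ltrBlDr lerBrDr.
rewrite lebesgue_measure_itv [RHS](lebesgue_measure_itv `]a - t, b - t]).
rewrite /= !lte_fin ltrD2r.
by case: ifP => // _; rewrite -!EFinD; congr (_%:E); ring.
Qed.

Lemma measurable_linear_form (a b : R) :
  measurable_fun [set: plane R] (fun p => a * p.1 + b * p.2).
Proof.
apply: (@measurable_funD _ _ _ _
  (fun p : plane R => a * p.1) (fun p : plane R => b * p.2)).
- exact: (measurable_funM (measurable_cst a) measurable_fst).
- exact: (measurable_funM (measurable_cst b) measurable_snd).
Qed.

Lemma measurable_linear_preimage (a b c d : R) (A : set (plane R)) :
  measurable A ->
  measurable ((fun p : plane R =>
    (a * p.1 + b * p.2, c * p.1 + d * p.2) : plane R) @^-1` A).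
Proof.
move=> mA; rewrite -[X in measurable X]setTI.
by apply: measurable_fun_pair => //; exact: measurable_linear_form.
Qed.

(** Fubini: on each vertical section the shear is a translation. *)
Lemma shear_snd (t : R) (A : set (plane R)) : measurable A ->
  mu ((fun p => (p.1, p.2 + t * p.1)) @^-1` A) = mu A.
Proof.
move=> mA; rewrite /mu /leb2 /product_measure1; apply: eq_integral => x _ /=.
rewrite -(lebesgue_measure_shift (t * x) (measurable_xsection x mA)).
by congr (leb _); apply/seteqP; split => y; rewrite /xsection/= !inE.
Qed.

(** Integrating in the other order gives access to horizontal sections, for the shear of the first
    coordinate. *)
Lemma leb2E (A : set (plane R)) : measurable A ->
  mu A = (leb \x^ leb)%E A.
Proof.
move=> mA; apply: product_measure_unique => // B C mB mC /=.
exact: product_measure2E.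
Qed.

Lemma shear_fst (t : R) (A : set (plane R)) : measurable A ->
  mu ((fun p => (p.1 + t * p.2, p.2)) @^-1` A) = mu A.
Proof.
move=> mA; rewrite !leb2E //; last first.
  rewrite -[X in measurable X]setTI; apply: measurable_fun_pair => //.
  by apply: measurable_funD => //; apply: measurable_funM.
rewrite /product_measure2; apply: eq_integral => y _ /=.
rewrite -(lebesgue_measure_shift (t * y) (measurable_ysection y mA)).
by congr (leb _); apply/seteqP; split => x; rewrite /ysection/= !inE.
Qed.

(** A matrix of determinant 1 whose lower left entry is nonzero is a product of three shears,
    alternately of the first, second and first coordinate. *)
Lemma leb2_linear (a b c d : R) (A : set (plane R)) : measurable A ->
  a * d - b * c = 1 ->
  mu ((fun p => (a * p.1 + b * p.2, c * p.1 + d * p.2)) @^-1` A) = mu A.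
Proof.
have mS1 t B : measurable B ->
    measurable ((fun p : plane R => (p.1, p.2 + t * p.1)) @^-1` B).
  move=> mB; rewrite -[X in measurable X]setTI; apply: measurable_fun_pair => //.
  by apply: measurable_funD => //; apply: measurable_funM.
have mS2 t B : measurable B ->
    measurable ((fun p : plane R => (p.1 + t * p.2, p.2)) @^-1` B).
  move=> mB; rewrite -[X in measurable X]setTI; apply: measurable_fun_pair => //.
  by apply: measurable_funD => //; apply: measurable_funM.
move=> mA.
have main a' b' c' d' : c' != 0 -> a' * d' - b' * c' = 1 ->
  mu ((fun p => (a' * p.1 + b' * p.2, c' * p.1 + d' * p.2)) @^-1` A) = mu A.
  move=> c0 det.
  rewrite -(shear_fst ((a' - 1) / c') mA) -(shear_snd c' (mS2 _ _ mA)).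
  rewrite -(shear_fst ((d' - 1) / c') (mS1 _ _ (mS2 _ _ mA))).
  have b'E : b' = (a' * d' - 1) / c' by rewrite -det; field.
  congr (mu _); apply/seteqP; split => -[x y] /=; congr (A (_, _));
    rewrite ?b'E; by field.
have [c0 det|c0 det] := eqVneq c 0; last exact: main.
rewrite c0 mulr0 subr0 in det.
have d0 : d != 0 by apply: contra_eq_neq det => ->; rewrite mulr0 eq_sym oner_eq0.
have mL := measurable_linear_preimage a b c d mA.
(* When [c = 0], composing with a shear brings [d], which is nonzero, into the lower left corner. *)
rewrite -(shear_snd 1 mL) -(main (a + b) b d d) //; last by rewrite -det; ring.
by congr (mu _); apply/seteqP; split => -[x y] /=; congr (A (_, _));
  rewrite ?c0; ring.
Qed.

End plane_measure.

(** * Dyadic squares and comparison of measures *)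

Section dyadic.
Variable R : realType.
Local Notation mu := (@leb2 R).

Definition dyadic_index (n : nat) (p : plane R) : int * int :=
  (Num.floor (2 ^+ n * p.1 : R), Num.floor (2 ^+ n * p.2 : R)).

(** Nesting of dyadic intervals: the floor of [x] is half that of [2 * x], rounded down. *)
Lemma floor_double_eq (x y : R) :
  Num.floor (2 * x) = Num.floor (2 * y) -> Num.floor x = Num.floor y.
Proof.
move=> e; apply/esym/floor_def; have := floor_itv x.
move: (Num.floor x) => m /andP[h1 h2].
rewrite intrD in h2.
have a1 : m + m <= Num.floor (2 * y) by rewrite -e floor_ge_int intrD; lra.
have a2 : Num.floor (2 * y) < m + m + 1 + 1.
  by rewrite -e floor_lt_int !intrD; lra.
move: a1 a2; rewrite floor_ge_int floor_lt_int !intrD => a1 a2.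
by apply/andP; split; lra.
Qed.

Lemma dyadic_close n (x y : R) :
  Num.floor (2 ^+ n * x) = Num.floor (2 ^+ n * y) -> `|x - y| < 2 ^- n.
Proof.
move=> xy; have := floor_itv (2 ^+ n * x); have := floor_itv (2 ^+ n * y).
rewrite xy intrD => /andP[h1 h2] /andP[h3 h4].
have n0 : 0 < 2 ^+ n :> R by rewrite exprn_gt0.
rewrite -(ltr_pM2l n0) divff ?gt_eqF// -[X in X * _](gtr0_norm n0) -normrM.
by rewrite ltr_norml; apply/andP; split; lra.
Qed.

Lemma dyadic_index_le (m n : nat) (p q : plane R) : (m <= n)%N ->
  dyadic_index n p = dyadic_index n q -> dyadic_index m p = dyadic_index m q.
Proof.
move=> /subnK <-; elim: (n - m)%N => // k ih; rewrite addSn => -[].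
rewrite !exprS -!mulrA => /floor_double_eq e1 /floor_double_eq e2.
by apply: ih; rewrite /dyadic_index e1 e2.
Qed.

(** A union, possibly infinite, of squares of one level, encoded as invariance under lying in the
    same square. Stability under union and difference is then immediate, and the whole plane is
    included. *)
Definition dyadic_set (A : set (plane R)) :=
  exists n, forall p q, dyadic_index n p = dyadic_index n q -> A p -> A q.

Lemma setring_dyadic : setring dyadic_set.
Proof.
split.
- by exists 0%N.
- move=> A B [m Am] [n Bn]; exists (maxn m n) => p q pq.
  by case=> h; [left; apply: Am h|right; apply: Bn h];
    apply: dyadic_index_le pq; rewrite ?leq_maxl ?leq_maxr.
- move=> A B [m Am] [n Bn]; exists (maxn m n) => p q pq [Ap nBp]; split.
    by apply: Am Ap; apply: dyadic_index_le pq; rewrite ?leq_maxl.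
  move=> Bq; apply: nBp; apply: Bn Bq.
  by apply/esym; apply: dyadic_index_le pq; rewrite leq_maxr.
Qed.

(** Rounding [x] down to level [n] approximates it from below, which turns an open half-plane into a
    countable union of dyadic sets. *)
Lemma gt_dyadicP (a x : R) :
  a < x <-> exists n, 2 ^+ n * a < (Num.floor (2 ^+ n * x))%:~R.
Proof.
split=> [ax|[n]]; last first.
  move=> /lt_le_trans/(_ (floor_le _)).
  by rewrite ltr_pM2l // exprn_gt0.
(* Since [2 ^+ n] exceeds [n], this level makes the mesh at most [x - a]. *)
exists (Num.truncn (x - a)^-1).+1.
set n := (X in 2 ^+ X); have n0 : 0 < 2 ^+ n :> R by rewrite exprn_gt0.
have : 1 <= 2 ^+ n * (x - a).
  rewrite -ler_pdivrMr ?subr_gt0// mul1r (le_trans (ltW (truncnS_gt _)))//.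
  by rewrite -natrX ler_nat ltnW// ltn_expl.
have := floorD1_gt (2 ^+ n * x); rewrite intrD; lra.
Qed.

(** Both coordinates are measurable for the generated sigma-algebra, hence so is the identity into
    the product. *)
Lemma measurable_dyadic : measurable `<=` <<s dyadic_set>>.
Proof.
pose T := g_sigma_algebraType dyadic_set.
have mfst : measurable_fun [set: T] (fst : T -> R).
  apply: (measurability _ (RGenOInfty.measurableE R)).
  move=> /= _ [_ [a ->] <-]; rewrite setTI.
  rewrite (_ : _ @^-1` _ = \bigcup_n
    [set p : T | 2 ^+ n * a < (Num.floor (2 ^+ n * (p.1 : R)))%:~R]).
    apply: bigcupT_measurable => n; apply: sub_sigma_algebra.
    by exists n => p q [+ _] /= => ->.
  apply/seteqP; split => p /=; rewrite in_itv/= andbT.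
    by move=> /gt_dyadicP[n ?]; exists n.
  by case=> n _ h; apply/gt_dyadicP; exists n.
have msnd : measurable_fun [set: T] (snd : T -> R).
  apply: (measurability _ (RGenOInfty.measurableE R)).
  move=> /= _ [_ [a ->] <-]; rewrite setTI.
  rewrite (_ : _ @^-1` _ = \bigcup_n
    [set p : T | 2 ^+ n * a < (Num.floor (2 ^+ n * (p.2 : R)))%:~R]).
    apply: bigcupT_measurable => n; apply: sub_sigma_algebra.
    by exists n => p q [_ +] /= => ->.
  apply/seteqP; split => p /=; rewrite in_itv/= andbT.
    by move=> /gt_dyadicP[n ?]; exists n.
  by case=> n _ h; apply/gt_dyadicP; exists n.
move=> A mA.
have := measurable_fun_pair (mfst : measurable_fun _ (fst : T -> measurableTypeR R))
  (msnd : measurable_fun _ (snd : T -> measurableTypeR R)) measurableT mA.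
rewrite setTI (_ : _ @^-1` A = A)//.
by apply/seteqP; split => -[].
Qed.

Lemma dyadic_squareE n k : [set p : plane R | dyadic_index n p = k] =
  `[k.1%:~R / 2 ^+ n, (k.1 + 1)%:~R / 2 ^+ n[%classic `*`
  `[k.2%:~R / 2 ^+ n, (k.2 + 1)%:~R / 2 ^+ n[%classic.
Proof.
case: k => k l /=.
have n0 : 0 < 2 ^+ n :> R by rewrite exprn_gt0.
have E (x : R) j : (x \in `[j%:~R / 2 ^+ n, (j + 1)%:~R / 2 ^+ n[) <->
    Num.floor (2 ^+ n * x) = j.
  rewrite in_itv/= ler_pdivrMr// ltr_pdivlMr// mulrC.
  by split=> [/floor_def//|<-]; exact: floor_itv.
apply/seteqP; split => [p [p1 p2]|p [/= /E p1 /E p2]].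
  by split; apply/E.
by rewrite /dyadic_index p1 p2.
Qed.

Lemma measurable_dyadic_square n k :
  measurable [set p : plane R | dyadic_index n p = k].
Proof.
by rewrite dyadic_squareE; apply: measurableX; exact: measurable_itv.
Qed.

Lemma leb2_dyadic_square n k :
  mu [set p : plane R | dyadic_index n p = k] = ((2 ^- n) ^+ 2)%:E.
Proof.
rewrite dyadic_squareE /mu /leb2 product_measure1E//; try exact: measurable_itv.
have itvE (j : int) : lebesgue_measure (`[j%:~R / 2 ^+ n,
    (j + 1)%:~R / 2 ^+ n[%classic : set (measurableTypeR R)) = (2 ^- n)%:E.
  have n0 : 0 < 2 ^- n :> R by rewrite invr_gt0 exprn_gt0.
  rewrite lebesgue_measure_itv /= lte_fin ifT -?EFinD.
    by congr (_%:E); rewrite intrD mulrDl mul1r addrAC subrr add0r.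
  by rewrite intrD ltr_pM2r// ltrDl.
by rewrite EFinM; congr (_ * _)%E; exact: itvE.
Qed.

(** The squares are numbered by [pickle]; a number that codes no square of [A] gives the empty
    set. *)
Lemma dyadic_partition (A : set (plane R)) : dyadic_set A ->
  exists (n : nat) (F : nat -> set (plane R)),
    [/\ forall k, F k = set0 \/ exists c, F k = [set p | dyadic_index n p = c],
        forall k, measurable (F k), trivIset setT F & \bigcup_k F k = A].
Proof.
move=> [n An].
pose F k := A `&` [set p | pickle (dyadic_index n p) = k].
have FE k : F k = set0 \/ exists c, F k = [set p | dyadic_index n p = c].
  have [|/set0P[p0 [Ap0 /= kE]]] := eqVneq (F k) set0; first by left.
  right; exists (dyadic_index n p0); apply/seteqP; split => p /=.
    by case=> _ /=; rewrite -kE; exact: (pcan_inj pickleK).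
  by move=> pE; split; [exact: An Ap0|rewrite /= pE].
exists n, F; split => // [k||].
- have [->//|[c ->]] := FE k; exact: measurable_dyadic_square.
- by move=> i j _ _ [p [[_ /= <-] [_ /= <-]]].
- apply/seteqP; split => [p [k _ []]//|p Ap].
  by exists (pickle (dyadic_index n p)).
Qed.

Lemma dyadic_set_measurable (A : set (plane R)) : dyadic_set A -> measurable A.
Proof.
by move=> /dyadic_partition[n [F [_ mF _ <-]]]; exact: bigcupT_measurable.
Qed.

(** An open set is the union of the dyadic squares that it contains. *)
Lemma open_plane_measurable (A : set (plane R)) :
  (forall p, A p -> exists2 e : R, 0 < e &
    forall q, `|q.1 - p.1| < e -> `|q.2 - p.2| < e -> A q) -> measurable A.
Proof.
move=> oA.
have -> : A = \bigcup_n
    [set p | forall q, dyadic_index n p = dyadic_index n q -> A q].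
  apply/seteqP; split => [p Ap|p [n _]]; last exact.
  have [e e0 eA] := oA _ Ap; exists (Num.truncn e^-1).+1 => // q.
  set n := (Num.truncn _).+1; have n0 : 0 < 2 ^+ n :> R by rewrite exprn_gt0.
  have en : 2 ^- n < e.
    rewrite invf_plt ?posrE// (lt_le_trans (truncnS_gt _))//.
    by rewrite -natrX ler_nat ltnW// ltn_expl.
  by move=> [/esym/dyadic_close q1 /esym/dyadic_close q2]; apply: eA => //;
    apply: lt_trans en.
apply: bigcupT_measurable => n; apply: dyadic_set_measurable.
by exists n => p q /= pq h r qr; apply: h; rewrite pq.
Qed.

Lemma leb2_square (u v r : R) : 0 <= r ->
  mu (`[u, u + r]%classic `*` `[v, v + r]%classic) = (r ^+ 2)%:E.
Proof.
move=> r0; rewrite /mu /leb2 product_measure1E//; try exact: measurable_itv.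
have itvE w : lebesgue_measure (`[w, w + r]%classic : set (measurableTypeR R)) = r%:E.
  rewrite lebesgue_measure_itv /= lte_fin; case: ifPn => [_|].
    by rewrite -EFinD; congr (_%:E); ring.
  by rewrite -leNgt => h; congr (_%:E); lra.
by rewrite EFinM; congr (_ * _)%E; exact: itvE.
Qed.

(* [E] lies in the preimage of a square of side [r] under an area-preserving
   linear map. *)
Lemma leb2_le_square (a b c d r : R) (E : set (plane R)) :
  measurable E -> a * d - b * c = 1 ->
  (forall p q, E p -> E q -> `|a * (p.1 - q.1) + b * (p.2 - q.2)| <= r /\
                             `|c * (p.1 - q.1) + d * (p.2 - q.2)| <= r) ->
  (mu E <= (r ^+ 2)%:E)%E.
Proof.
move=> mE det hr.
have [->|/set0P[p0 Ep0]] := eqVneq E set0.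
  by rewrite measure0 lee_fin exprn_even_ge0.
have r0 : 0 <= r by have [+ _] := hr _ _ Ep0 Ep0; exact: le_trans.
(* A function of oscillation at most [r] on [E] takes its values in the interval of length [r] that
   starts at their infimum. *)
have inf_itv (f : plane R -> R) : (forall p q, E p -> E q -> `|f p - f q| <= r) ->
    forall p, E p -> inf (f @` E) <= f p <= inf (f @` E) + r.
  move=> fr p Ep; apply/andP; split.
    apply: ge_inf; last by exists p.
    exists (f p0 - r) => _ [q Eq <-].
    by have := fr _ _ Ep0 Eq; rewrite ler_norml; lra.
  rewrite -lerBlDr; apply: lb_le_inf; first by exists (f p0), p0.
  by move=> _ [q Eq <-]; have := fr _ _ Ep Eq; rewrite ler_norml; lra.
pose f1 (p : plane R) : R := a * p.1 + b * p.2.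
pose f2 (p : plane R) : R := c * p.1 + d * p.2.
have h1 : forall p, E p -> inf (f1 @` E) <= f1 p <= inf (f1 @` E) + r.
  apply: inf_itv => p q Ep Eq; have [+ _] := hr _ _ Ep Eq.
  by congr (`|_| <= _); rewrite /f1; ring.
have h2 : forall p, E p -> inf (f2 @` E) <= f2 p <= inf (f2 @` E) + r.
  apply: inf_itv => p q Ep Eq; have [_ +] := hr _ _ Ep Eq.
  by congr (`|_| <= _); rewrite /f2; ring.
have mS : measurable (`[inf (f1 @` E), inf (f1 @` E) + r]%classic `*`
    `[inf (f2 @` E), inf (f2 @` E) + r]%classic : set (plane R)).
  by apply: measurableX; exact: measurable_itv.
rewrite -(leb2_square (inf (f1 @` E)) (inf (f2 @` E)) r0).
rewrite -(leb2_linear mS det); apply: le_measure; rewrite ?inE//.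
  exact: measurable_linear_preimage.
by move=> p Ep; split; rewrite /= in_itv/=; [exact: h1|exact: h2].
Qed.

(* By the monotone class theorem, domination on dyadic squares suffices. *)
Lemma dyadic_domination (m1 m2 : {measure set (plane R) -> \bar R}) (K : R) :
  0 <= K -> (m1 setT < +oo)%E -> (m2 setT < +oo)%E ->
  (forall n k, m1 [set p | dyadic_index n p = k] <=
     K%:E * m2 [set p | dyadic_index n p = k])%E ->
  forall A, measurable A -> (m1 A <= K%:E * m2 A)%E.
Proof.
move=> K0 fin1 fin2 sq.
pose H := [set A : set (plane R) | measurable A /\ (m1 A <= K%:E * m2 A)%E].
have finm (m : {measure set (plane R) -> \bar R}) (B : set (plane R)) :
    (m setT < +oo)%E -> measurable B -> (m B < +oo)%E.
  by move=> fm mB; apply: le_lt_trans fm; apply: le_measure; rewrite ?inE.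
(* Continuity from above, for decreasing sequences, is where the finiteness of both measures
   enters. *)
have monoH : monotone H.
  split=> F mF HF; split.
  - by apply: bigcupT_measurable => n; have [] := HF n.
  - have c1 : m1 (F n) @[n --> \oo] --> m1 (\bigcup_n F n).
      apply: nondecreasing_cvg_mu => //; first by move=> n; have [] := HF n.
      by apply: bigcupT_measurable => n; have [] := HF n.
    have c2 : m2 (F n) @[n --> \oo] --> m2 (\bigcup_n F n).
      apply: nondecreasing_cvg_mu => //; first by move=> n; have [] := HF n.
      by apply: bigcupT_measurable => n; have [] := HF n.
    have {}c2 : (K%:E * m2 (F n))%E @[n --> \oo] --> (K%:E * m2 (\bigcup_n F n))%E.
      exact: cvgeZl.
    apply: (lee_cvg_to c1 c2); apply: nearW => n; exact: (HF n).2.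
  - by apply: bigcapT_measurable => n; have [] := HF n.
  - have c1 : m1 (F n) @[n --> \oo] --> m1 (\bigcap_n F n).
      apply: nonincreasing_cvg_mu => //.
      + by apply: finm => //; exact: (HF 0%N).1.
      + by move=> n; have [] := HF n.
      + by apply: bigcapT_measurable => n; have [] := HF n.
    have c2 : m2 (F n) @[n --> \oo] --> m2 (\bigcap_n F n).
      apply: nonincreasing_cvg_mu => //.
      + by apply: finm => //; exact: (HF 0%N).1.
      + by move=> n; have [] := HF n.
      + by apply: bigcapT_measurable => n; have [] := HF n.
    have {}c2 : (K%:E * m2 (F n))%E @[n --> \oo] --> (K%:E * m2 (\bigcap_n F n))%E.
      exact: cvgeZl.
    apply: (lee_cvg_to c1 c2); apply: nearW => n; exact: (HF n).2.
have ringH : dyadic_set `<=` H.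
  move=> A /dyadic_partition[n [F [FE mF tF UF]]].
  split; first by rewrite -UF; exact: bigcupT_measurable.
  rewrite -UF !measure_semi_bigcup//; try by rewrite UF -UF; exact: bigcupT_measurable.
  rewrite -nneseriesZl//.
  apply: lee_nneseries => // i _.
  by have [->|[c ->]] := FE i; [rewrite !measure0 mule0|exact: sq].
have srH := monotone_setring_sub_g_sigma_ring monoH setring_dyadic ringH.
move=> A /measurable_dyadic sA.
suff : H A by case.
(* The sigma-ring generated by the dyadic sets contains the whole plane, so it is closed under
   complements and is a sigma-algebra. *)
apply: srH; apply: sA; split; last exact: sub_g_sigma_ring.
have [s0 sD sU] := smallest_sigma_ring dyadic_set.
split => // B sB; apply: sD => //; apply: sub_g_sigma_ring.
by exists 0%N.
Qed.

End dyadic.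

(** * Area of preimages under near-isometries *)

Section near_isometry.
Variable R : realType.
Local Notation mu := (@leb2 R).

(* Up to an area-preserving linear map at the source, the inverse of [F] on
   [F @` G] is [K]-Lipschitz for the sup norm. *)
Definition near_isometry (K : R) (G : set (plane R)) (F : plane R -> plane R) :=
  exists a b c d : R, a * d - b * c = 1 /\
    forall p q (r : R), G p -> G q ->
      `|(F p).1 - (F q).1| <= r -> `|(F p).2 - (F q).2| <= r ->
      `|a * (p.1 - q.1) + b * (p.2 - q.2)| <= K * r /\
      `|c * (p.1 - q.1) + d * (p.2 - q.2)| <= K * r.

Variables (D : set (plane R)) (F : plane R -> plane R).
Hypothesis mD : measurable D.
Hypothesis mF : forall B, measurable B -> measurable (D `&` F @^-1` B).

(** A pushforward requires a map of the whole plane, so [F] is made constant off [D]; restricting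
    the measure to a subset of [D] then discards that constant value. *)
Lemma patch_measurable : measurable_fun [set: plane R] (patch (fun=> point) D F).
Proof.
move=> _ B mB; rewrite setTI.
have -> : patch (fun=> point) D F @^-1` B = (D `&` F @^-1` B) `|`
    (~` D `&` [set _ | B point]).
  apply/seteqP; split => p; rewrite /patch /preimage /=.
    case: ifPn => [/set_mem Dp Bp|/negP Dp Bp]; first by left.
    by right; split => // Dp'; apply: Dp; exact: mem_set.
  by case=> -[Dp Bp]; [rewrite (mem_set Dp)|rewrite memNset].
apply: measurableU; first exact: mF.
have [Bp|Bp] := pselect (B point).
  by rewrite (_ : [set _ | _] = setT) ?setIT; [exact: measurableC|apply/seteqP; split].
by rewrite (_ : [set _ | _] = set0) ?setI0//; apply/seteqP; split.
Qed.

Lemma preimage_measure_exists (G : set (plane R)) : measurable G ->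
  exists nu : {measure set (plane R) -> \bar R},
    forall B, nu B = mu (D `&` F @^-1` (B `&` G)).
Proof.
move=> mG.
have [nu nuE] := pushforward_measure_exists (mrestr mu (mF mG)) patch_measurable.
exists nu => B; rewrite nuE /mrestr; congr (mu _); apply/seteqP; split => p /=.
  by rewrite /patch => -[+ [Dp Gp]]; rewrite (mem_set Dp).
by move=> [Dp [Bp Gp]]; rewrite /patch (mem_set Dp).
Qed.

Lemma restriction_measure_exists (W : set (plane R)) : measurable W ->
  exists nu : {measure set (plane R) -> \bar R},
    forall B, nu B = mu (B `&` W).
Proof. by move=> mW; exists (mrestr mu mW). Qed.

(** The square of side [2 * N] centred at the origin, written with floors so that it is a union of
    squares of level 0: a dyadic square lies inside it or misses it. *)
Definition dyadic_box (N : nat) : set (plane R) :=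
  [set p | - N%:Z <= Num.floor (p.1 : R) < N%:Z /\
           - N%:Z <= Num.floor (p.2 : R) < N%:Z].

Lemma dyadic_boxP N (p : plane R) : dyadic_box N p <->
  [/\ - N%:R <= p.1, p.1 < N%:R, - N%:R <= p.2 & p.2 < N%:R].
Proof.
rewrite /dyadic_box /= !floor_ge_int !floor_lt_int !mulrNz -!pmulrn.
by split=> [[/andP[? ?] /andP[? ?]]|[-> -> -> ->]].
Qed.

Lemma dyadic_box_square N n k :
  [set p | dyadic_index n p = k] `<=` dyadic_box N \/
  [set p | dyadic_index n p = k] `&` dyadic_box N = set0.
Proof.
have [|sub] := pselect ([set p | dyadic_index n p = k] `<=` dyadic_box N).
  by left.
right; apply/seteqP; split => // p [/= pk Wp]; apply: sub => q /= qk.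
have /(dyadic_index_le (leq0n n)) [] : dyadic_index n p = dyadic_index n q.
  by rewrite pk.
by move: Wp; rewrite /dyadic_box /= expr0 !mul1r => + <- <-.
Qed.

Lemma measurable_dyadic_box N : measurable (dyadic_box N).
Proof.
apply: dyadic_set_measurable; exists 0%N => p q.
by rewrite /dyadic_index /dyadic_box /= expr0 !mul1r => -[-> ->].
Qed.

Lemma leb2_dyadic_box N : (mu (dyadic_box N) < +oo)%E.
Proof.
have := leb2_square (- N%:R) (- N%:R) (ler0n R N.*2) => boxE.
apply: (@le_lt_trans _ _ ((N.*2%:R ^+ 2)%:E)); last exact: ltry.
rewrite -boxE; apply: le_measure; rewrite ?inE.
- exact: measurable_dyadic_box.
- by apply: measurableX; exact: measurable_itv.
- move=> p /dyadic_boxP[p1 p2 p3 p4]; split; rewrite /= in_itv/= -addnn natrD.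
    by rewrite p1 addKr ltW.
  by rewrite p3 addKr ltW.
Qed.

(** The preimage of a dyadic square of side [s] has, after the linear map, coordinates varying by at
    most [K * s], hence area at most [(K * s) ^+ 2]; domination on squares extends to [A].
    Restricting area to the box that contains the values of [F] makes the comparison measure
    finite. *)
Lemma near_isometry_measure_le (K : R) (N : nat) (G A : set (plane R)) :
  0 < K -> (mu D < +oo)%E ->
  (forall p, D p -> `|(F p).1| < N%:R /\ `|(F p).2| < N%:R) ->
  measurable G -> near_isometry K (D `&` F @^-1` G) F ->
  measurable A ->
  (mu (D `&` F @^-1` (A `&` G)) <= (K ^+ 2)%:E * mu A)%E.
Proof.
move=> K0 finD FN mG [a [b [c [d [det iso]]]]] mA.
have [nu nuE] := preimage_measure_exists mG.
have mW := measurable_dyadic_box N.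
have [rho rhoE] := restriction_measure_exists mW.
have DW p : D p -> dyadic_box N (F p).
  move=> /FN[]; rewrite !ltr_norml => /andP[? ?] /andP[? ?].
  by apply/dyadic_boxP; split => //; exact: ltW.
have h : (nu A <= (K ^+ 2)%:E * rho A)%E.
  apply: dyadic_domination mA; first by rewrite sqr_ge0.
  - rewrite nuE; apply: le_lt_trans finD; apply: le_measure; rewrite ?inE//.
    by apply: mF; exact: measurableI.
  - by rewrite rhoE setTI; exact: leb2_dyadic_box.
  - move=> n k; set Q := [set p | _].
    have mQ : measurable Q by exact: measurable_dyadic_square.
    rewrite nuE rhoE.
    (* A square that misses the box contains no value of [F] on [D], so its preimage is empty. *)
    have [QW|QW] := dyadic_box_square N n k; last first.
      rewrite (_ : D `&` _ = set0) ?measure0 ?mule_ge0 ?lee_fin ?sqr_ge0//.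
      apply/seteqP; split => // p [Dp [/= Qp Gp]].
      have : (Q `&` dyadic_box N) (F p) by split => //; exact: DW.
      by rewrite QW.
    rewrite (setIidl QW) /Q leb2_dyadic_square -EFinM -exprMn.
    apply: (leb2_le_square _ det); first by apply: mF; exact: measurableI.
    have close (x y : R) : Num.floor (2 ^+ n * x) = Num.floor (2 ^+ n * y) ->
        `|x - y| <= 2 ^- n by move=> /dyadic_close/ltW.
    move=> p q [Dp [/= Qp Gp]] [Dq [/= Qq Gq]].
    have [e1 e2] : dyadic_index n (F p) = dyadic_index n (F q) by rewrite Qp Qq.
    by apply: iso => //; exact: close.
rewrite -nuE; apply: (le_trans h); rewrite rhoE.
rewrite lee_pmul2l ?lte_fin ?exprn_gt0//.
by apply: le_measure; rewrite ?inE//; exact: measurableI.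
Qed.

(** For each [K] the estimates on disjoint parts of the target add up to the factor [K ^+ 2]; then
    [K] tends to 1. *)
Lemma near_isometry_preimage_le (N : nat) :
  (mu D < +oo)%E ->
  (forall p, D p -> `|(F p).1| < N%:R /\ `|(F p).2| < N%:R) ->
  (forall K, 1 < K -> exists G : nat -> set (plane R),
    [/\ forall j, measurable (G j), forall p, D p -> exists j, G j (F p) &
        forall j, near_isometry K (D `&` F @^-1` (G j)) F]) ->
  forall A, measurable A -> (mu (D `&` F @^-1` A) <= mu A)%E.
Proof.
move=> finD FN cover A mA.
have le_K K : 1 < K -> (mu (D `&` F @^-1` A) <= (K ^+ 2)%:E * mu A)%E.
  move=> K1; have [G [mG DG iso]] := cover _ K1.
  have K0 : 0 < K by exact: lt_trans K1.
  pose H := seqDU G.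
  have mH k : measurable (H k) by exact: seqDU_measurable.
  have tH : trivIset setT H by exact: trivIset_seqDU.
  (* Both factors are kept: [H k] makes the parts disjoint, and over [G k] the map is a
     near-isometry. *)
  have -> : D `&` F @^-1` A = \bigcup_k (D `&` F @^-1` (A `&` H k `&` G k)).
    apply/seteqP; split => [p [Dp Ap]|p [k _ [? [[? _] _]]]]//.
    have [j Gj] := DG _ Dp.
    have : (\bigcup_k H k) (F p) by rewrite -seqDU_bigcup_eq; exists j.
    case=> k _ Hk; exists k => //; split => //; split => //.
    by have [] := Hk.
  have mAHG k : measurable (A `&` H k `&` G k).
    by apply: measurableI => //; exact: measurableI.
  rewrite measure_semi_bigcup//; last 3 first.
  - by move=> k; exact: mF.
  - move=> i j _ _ [p [[_ [[_ Hi] _]] [_ [[_ Hj] _]]]].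
    by apply: tH => //; exists (F p).
  - by apply: bigcupT_measurable => k; exact: mF.
  apply: (@le_trans _ _ (\sum_(0 <= k <oo) (K ^+ 2)%:E * mu (A `&` H k))%E).
    apply: lee_nneseries => // k _.
    apply: (near_isometry_measure_le _ _ FN) => //; exact: measurableI.
  rewrite nneseriesZl// lee_pmul2l ?lte_fin ?exprn_gt0//.
  rewrite -measure_semi_bigcup//; last 3 first.
  - by move=> k; exact: measurableI.
  - move=> i j _ _ [p [[_ Hi] [_ Hj]]].
    by apply: tH => //; exists p.
  - by apply: bigcupT_measurable => k; exact: measurableI.
  apply: le_measure; rewrite ?inE//.
    by apply: bigcupT_measurable => k; exact: measurableI.
  by move=> p [k _ []].
have [->|finA] := eqVneq (mu A) +oo%E; first exact: leey.
have : mu A \is a fin_num by rewrite ge0_fin_numE// ltey.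
move=> /fineK; set m := fine _ => muA.
have m0 : 0 <= m by exact: fine_ge0.
apply/lee_addgt0Pr => e e0.
have m1 : 0 < m + 1 by lra.
(* With this choice [K ^+ 2 * m] is at most [m + e]; the denominator [m + 1] also covers [m = 0]. *)
pose K := Num.sqrt (1 + e / (m + 1)).
have K1 : 1 < K.
  by rewrite -[ltLHS]sqrtr1 ltr_sqrt ?ltrDl ?divr_gt0// ltr_wpDr// divr_ge0// ltW.
apply: (le_trans (le_K _ K1)); rewrite -muA -EFinM -EFinD lee_fin sqr_sqrtr; last first.
  by rewrite addr_ge0// divr_ge0// ltW.
rewrite mulrDl mul1r lerD2l mulrAC ler_pdivrMr// ler_pM2l//; lra.
Qed.

End near_isometry.

(** * The cylinder and its charts *)

Section circle.
Variable R : realType.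

Lemma angD (x y : R) : ang (x + y) = ang x + ang y.
Proof. exact: raddfD. Qed.

Lemma ang_eqP (x y : R) : ang x = ang y <-> exists m : int, x = y + m%:~R.
Proof.
rewrite /ang; split.
  move=> /eqP; rewrite piE Quotient.equivE => /intrP[m xy].
  by exists m; rewrite -xy addrC subrK.
move=> [m ->]; apply/eqP; rewrite piE Quotient.equivE addrAC subrr add0r.
exact: intr_int.
Qed.

(** The representative in [[0, 1)]: subtracting the floor removes the dependence on the choice made
    by [repr]. *)
Definition ang_sec (t : circle R) : R :=
  let x : R := repr t in x - (Num.floor x)%:~R.

Lemma ang_secK t : ang (ang_sec t) = t.
Proof.
rewrite -[RHS](reprK t); apply/ang_eqP; exists (- Num.floor (repr t : R)).
by rewrite mulrNz.
Qed.

Lemma ang_sec_itv t : 0 <= ang_sec t < 1.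
Proof.
by have := floor_itv (repr t : R); rewrite /ang_sec intrD => /andP[? ?]; lra.
Qed.

Lemma intr_small (m : int) : `|m%:~R : R| < 1 -> m = 0.
Proof.
by rewrite -intr_norm ltrz1 ltNge -gtz0_ge1 normr_gt0 negbK => /eqP.
Qed.

Lemma ang_inj (x y : R) : ang x = ang y -> `|x - y| < 1 -> x = y.
Proof.
move=> /ang_eqP[m ->]; rewrite addrAC subrr add0r => /intr_small ->.
by rewrite addr0.
Qed.

Lemma ang_sec_uniq (x : R) t : 0 <= x < 1 -> ang x = t -> ang_sec t = x.
Proof.
move=> x01 xt; apply: ang_inj; first by rewrite ang_secK.
by have := ang_sec_itv t; rewrite ltr_norml; lra.
Qed.

End circle.

(** * Continuity and differentiability in charts *)

Section charts.
Variable R : realType.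
Implicit Types (D : set (cylinder R)) (z : cylinder R) (f : cylinder R -> cylinder R).

(** This is [cov] on pairs, the form in which the plane carries its product measure. *)
Definition wrap (p : R * R) : cylinder R := (p.1, ang p.2).

Definition coord z : R * R := (z.1, ang_sec z.2).

Lemma coordK z : wrap (coord z) = z.
Proof. by case: z => x t; rewrite /wrap /coord /= ang_secK. Qed.

Lemma wrapD (p q : R * R) : wrap (p + q) = wrap p + wrap q.
Proof. by rewrite /wrap /= angD. Qed.

Lemma cov_vec (u v : R) : cov (vec u v) = wrap (u, v).
Proof. by rewrite /cov /vec !mxE. Qed.

Lemma covE (h : 'cV[R]_2) : cov h = wrap (h 0 0, h 1 0).
Proof. by []. Qed.

Lemma cov0 : cov (0 : 'cV[R]_2) = 0.
Proof. by rewrite /cov !mxE /ang raddf0. Qed.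

Lemma coef_le_norm (h : 'cV[R]_2) i : `|h i 0| <= `|h|.
Proof.
rewrite [leRHS]/Num.norm/= mx_normrE.
exact: (le_bigmax_cond _ (fun ij : 'I_2 * 'I_1 => `|h ij.1 ij.2|)
  (erefl : xpredT (i, 0))).
Qed.

Lemma norm_vec (u v : R) : `|vec u v| = Num.max `|u| `|v|.
Proof.
apply/le_anti/andP; split.
  rewrite [leLHS]/Num.norm/= mx_normrE; apply: bigmax_le.
    by rewrite le_max normr_ge0.
  move=> [i j] _; rewrite /vec mxE /=; case: ifP => _; rewrite le_max lexx ?orbT//.
rewrite ge_max; apply/andP; split.
  by have := coef_le_norm (vec u v) 0; rewrite mxE.
by have := coef_le_norm (vec u v) 1; rewrite mxE.
Qed.

Lemma mulmx_vecE (A : 'M[R]_2) (u v : R) i :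
  (A *m vec u v) i 0 = A i 0 * u + A i 1 * v.
Proof.
rewrite mxE !big_ord_recl big_ord0 addr0 /vec !mxE /=.
by rewrite (_ : lift _ _ = 1)//; exact: val_inj.
Qed.

Lemma nbhs0_vec (P : set 'cV[R]_2) : (\forall h \near (0 : 'cV[R]_2), P h) ->
  exists2 d : R, 0 < d & forall u v, `|u| < d -> `|v| < d -> P (vec u v).
Proof.
move=> /nbhs_norm0P[d /= d0 dP]; exists d => // u v ud vd; apply: dP => /=.
by rewrite norm_vec gt_max ud.
Qed.

(** The circle is a bare group, so smallness is asked of some lift of the increment of [f] to the
    plane. *)
Definition chart_continuous D f := forall z, D z -> forall e : R, 0 < e ->
  exists2 d : R, 0 < d & forall u v, `|u| < d -> `|v| < d ->
    D (z + wrap (u, v)) -> exists k1 k2 : R,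
    [/\ f (z + wrap (u, v)) = f z + wrap (k1, k2), `|k1| < e & `|k2| < e].

(** Continuity of the inverse on the image, without naming the inverse; the case [u = v = 0]
    contains injectivity. *)
Definition chart_inverse_continuous D f := forall z, D z -> forall e : R, 0 < e ->
  exists2 r : R, 0 < r & forall u v, `|u| < r -> `|v| < r -> forall z', D z' ->
    f z' = f z + wrap (u, v) ->
    exists k1 k2 : R, [/\ z' = z + wrap (k1, k2), `|k1| < e & `|k2| < e].

Definition chart_differentiable D f (a b c d : cylinder R -> R) :=
  forall z, D z -> forall e : R, 0 < e ->
  exists2 r : R, 0 < r & forall u v, `|u| < r -> `|v| < r ->
    D (z + wrap (u, v)) -> exists k1 k2 : R,
    [/\ f (z + wrap (u, v)) = f z + wrap (k1, k2),
        `|k1 - (a z * u + b z * v)| <= e * Num.max `|u| `|v| &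
        `|k2 - (c z * u + d z * v)| <= e * Num.max `|u| `|v|].

Lemma C1_map_differentiable D f Df : C1_map D f Df ->
  chart_differentiable D f (fun z => Df z 0 0) (fun z => Df z 0 1)
    (fun z => Df z 1 0) (fun z => Df z 1 1).
Proof.
move=> [fD _] z Dz e e0; have /nbhs0_vec[r r0 rP] := fD z Dz e e0.
exists r => // u v ur vr Dzuv.
have [|k fk kh] := rP u v ur vr; first by rewrite cov_vec.
have kE i : `|k i 0 - (Df z i 0 * u + Df z i 1 * v)| <= e * Num.max `|u| `|v|.
  by have := le_trans (coef_le_norm _ i) kh; rewrite norm_vec !mxE -mulmx_vecE mxE.
by exists (k 0 0), (k 1 0); rewrite -covE -fk cov_vec.
Qed.

Lemma linear_form_le (a b u v : R) :
  `|a * u + b * v| <= (`|a| + `|b|) * Num.max `|u| `|v|.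
Proof.
rewrite (le_trans (ler_normD _ _))// mulrDl !normrM.
by apply: lerD; apply: ler_wpM2l => //; rewrite le_max lexx ?orbT.
Qed.

Lemma chart_differentiable_small D f a b c d :
  chart_differentiable D f a b c d ->
  forall z, D z -> forall e e' : R, 0 < e -> 0 < e' ->
  exists2 r : R, 0 < r & forall u v, `|u| < r -> `|v| < r ->
    D (z + wrap (u, v)) -> exists k1 k2 : R,
    [/\ f (z + wrap (u, v)) = f z + wrap (k1, k2),
        `|k1 - (a z * u + b z * v)| <= e * Num.max `|u| `|v|,
        `|k2 - (c z * u + d z * v)| <= e * Num.max `|u| `|v|,
        `|k1| < e' & `|k2| < e'].
Proof.
move=> fD z Dz e e' e0 e'0; have [r r0 rP] := fD z Dz e e0.
(* [B] bounds the ratio of the increment of [f] to that of the point, in the sup norm. *)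
set B := `|a z| + `|b z| + `|c z| + `|d z| + e.
have B0 : 0 < B by rewrite /B ltr_wpDl// !addr_ge0.
exists (Num.min r (e' / B)) => [|u v]; first by rewrite lt_min r0 divr_gt0.
rewrite !lt_min => /andP[ur uB] /andP[vr vB] Dzuv.
have [k1 [k2 [fk h1 h2]]] := rP u v ur vr Dzuv.
set M := Num.max _ _ in h1 h2.
have Me : B * M < e' by rewrite mulrC -ltr_pdivlMr// gt_max uB.
have M0 : 0 <= M by rewrite le_max normr_ge0.
have bound (k x y : R) : `|x| + `|y| + e <= B ->
    `|k - (x * u + y * v)| <= e * M -> `|k| < e'.
  move=> xyB kM; apply: le_lt_trans Me.
  rewrite -[k](subrK (x * u + y * v)) (le_trans (ler_normD _ _))//.
  have := linear_form_le x y u v; rewrite -/M; nra.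
have := normr_ge0 (a z); have := normr_ge0 (b z).
have := normr_ge0 (c z); have := normr_ge0 (d z) => d1 c1 b1 a1.
exists k1, k2; split => //.
  by apply: (bound _ (a z) (b z)) => //; rewrite /B; lra.
by apply: (bound _ (c z) (d z)) => //; rewrite /B; lra.
Qed.

Lemma chart_differentiable_continuous D f a b c d :
  chart_differentiable D f a b c d -> chart_continuous D f.
Proof.
move=> fD z Dz e e0.
have [r r0 rP] := chart_differentiable_small fD Dz ltr01 e0; exists r => //.
by move=> u v ur vr /(rP u v ur vr)[k1 [k2 [? _ _ ? ?]]]; exists k1, k2.
Qed.

End charts.

(** * Planar reading of maps of the cylinder, and measurability *)

Section cell.
Variable R : realType.
Local Notation mu := (@leb2 R).

(* The line [p.2 = 0] is left out so that a small displacement on the cylinder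
   between points of the cell is a small displacement in the plane. *)
Definition cell (D : set (cylinder R)) : set (plane R) :=
  [set p | 0 < p.2 < 1 /\ D (wrap p)].

Definition planar (f : cylinder R -> cylinder R) (p : plane R) : plane R :=
  coord (f (wrap p)).

Lemma wrapB (p q : R * R) : wrap p = wrap q + wrap (p.1 - q.1, p.2 - q.2).
Proof.
rewrite -wrapD; congr wrap; case: p => ? ?; case: q => ? ? /=.
by congr (_, _); rewrite /= addrC subrK.
Qed.

(** [A] is the trace on [B] of the open set [O], a union of squares centred in [A] whose points of
    [B] all lie in [A]. *)
Lemma relatively_open_measurable (B A : set (plane R)) : measurable B ->
  A `<=` B ->
  (forall p, A p -> exists2 e : R, 0 < e & forall q, B q ->
    `|q.1 - p.1| < e -> `|q.2 - p.2| < e -> A q) -> measurable A.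
Proof.
move=> mB AB oA.
pose O := [set q : plane R | exists p (e : R), [/\ A p, `|q.1 - p.1| < e,
  `|q.2 - p.2| < e & forall q', B q' ->
    `|q'.1 - p.1| < e -> `|q'.2 - p.2| < e -> A q']].
have -> : A = B `&` O.
  apply/seteqP; split => [p Ap|p [Bp [p0 [e [Ap0 p1 p2]]]]]; last exact.
  split; first exact: AB.
  by have [e e0 eA] := oA _ Ap; exists p, e; split; rewrite // subrr normr0.
apply: measurableI => //; apply: open_plane_measurable => q [p [e [Ap q1 q2 eA]]].
exists (e - Num.max `|q.1 - p.1| `|q.2 - p.2|); first by rewrite subr_gt0 gt_max q1.
move=> q' h1 h2; exists p, e; split => //.
  rewrite -(subrK q.1 q'.1) -addrA (le_lt_trans (ler_normD _ _))//.
  by rewrite -ltrBrDr (lt_le_trans h1)// lerB// le_max lexx.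
rewrite -(subrK q.2 q'.2) -addrA (le_lt_trans (ler_normD _ _))//.
by rewrite -ltrBrDr (lt_le_trans h2)// lerB// le_max lexx orbT.
Qed.

Definition chart_continuous_fun (D : set (cylinder R)) (g : cylinder R -> R) :=
  forall z, D z -> forall e : R, 0 < e ->
  exists2 r : R, 0 < r & forall u v, `|u| < r -> `|v| < r ->
    D (z + wrap (u, v)) -> `|g (z + wrap (u, v)) - g z| < e.

Lemma chart_continuous_fun_measurable D g (B : set (plane R)) : measurable B ->
  B `<=` (fun p => D (wrap p)) -> chart_continuous_fun D g ->
  measurable_fun B (fun p => g (wrap p)).
Proof.
move=> mB BD cg; apply: (measurability _ (RGenOInfty.measurableE R)) => //.
move=> /= _ [_ [a ->] <-].
apply: (@relatively_open_measurable B) => // p [Bp /=].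
rewrite in_itv/= andbT => ap.
have [e e0 eP] := cg _ (BD _ Bp) (g (wrap p) - a) ltac:(by rewrite subr_gt0).
exists e => // q Bq q1 q2; split => //=; rewrite in_itv/= andbT.
have := eP _ _ q1 q2; rewrite -wrapB => /(_ (BD _ Bq)).
by rewrite ltr_norml => /andP[]; lra.
Qed.

Lemma chart_continuous_fst D f : chart_continuous D f ->
  chart_continuous_fun D (fun z => (f z).1).
Proof.
move=> cf z Dz e e0; have [r r0 rP] := cf z Dz e e0; exists r => //.
move=> u v ur vr /(rP u v ur vr)[k1 [k2 [-> k1e _]]] /=.
by rewrite addrAC subrr add0r.
Qed.

(** Serves for [dthS], whose continuity is given along the image of [D] under the rotation. *)
Lemma continuous_along_comp D f (g : cylinder R -> R) :
  chart_continuous D f -> continuous_along (f @` D) g ->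
  chart_continuous_fun D (g \o f).
Proof.
move=> cf cg z Dz e e0.
have /cvgrPdist_lt/(_ e e0) : g (f z + cov h) @[h -->
    within [set h | (f @` D) (f z + cov h)] (nbhs (0 : 'cV[R]_2))] --> g (f z).
  by apply: cg; exists z.
rewrite near_withinE => /nbhs0_vec[r r0 rP].
have [s s0 sP] := cf z Dz r r0; exists s => // u v us vs Dzuv.
have [k1 [k2 [fk k1r k2r]]] := sP u v us vs Dzuv.
have := rP k1 k2 k1r k2r; rewrite cov_vec /= -fk distrC; apply.
by exists (z + wrap (u, v)) => //; rewrite cov_vec.
Qed.

(** The angle read in [[0, 1)] jumps at 0 but is lower semicontinuous: where it exceeds some
    [a >= 0] it is away from the jump, and for [a < 0] there is no condition. *)
Lemma planar_snd_measurable D f : measurable (cell D) -> chart_continuous D f ->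
  measurable_fun (cell D) (fun p => (planar f p).2 : R).
Proof.
move=> mD cf; apply: (measurability _ (RGenOInfty.measurableE R)) => //.
move=> /= _ [_ [a ->] <-].
have [a0|a0] := ltP a 0.
  rewrite (_ : _ `&` _ = cell D)//; apply/seteqP; split => [p []//|p Dp].
  split => //=; rewrite in_itv/= andbT (lt_le_trans a0)//.
  by have /andP[] := ang_sec_itv (f (wrap p)).2.
apply: (@relatively_open_measurable (cell D)) => // p [Dp /=].
rewrite in_itv/= andbT => ap.
set t := (planar f p).2 in ap; have t1 : t < 1.
  by have /andP[] := ang_sec_itv (f (wrap p)).2.
(* An angular displacement below both bounds keeps the angle above [a] without wrapping around. *)
have [e e0 eP] := cf _ Dp.2 (Num.min (t - a) (1 - t))
  ltac:(by rewrite lt_min !subr_gt0 ap).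
exists e => // q Dq q1 q2; split => //=; rewrite in_itv/= andbT.
have [|k1 [k2 [fq _]]] := eP _ _ q1 q2; first by rewrite -wrapB; exact: Dq.2.
rewrite lt_min => /andP[]; rewrite !ltr_norml => /andP[k2a _] /andP[_ k2t].
move: fq; rewrite -wrapB /planar => fq.
rewrite (@ang_sec_uniq _ (t + k2) (f (wrap q)).2); first by lra.
  by apply/andP; split; lra.
by rewrite fq angD /t /planar /= ang_secK.
Qed.

Lemma planar_preimage_measurable D f : measurable (cell D) ->
  chart_continuous D f ->
  forall B, measurable B -> measurable (cell D `&` planar f @^-1` B).
Proof.
move=> mD cf B mB.
have m1 : measurable_fun (cell D) (fun p => (planar f p).1 : measurableTypeR R).
  exact: (chart_continuous_fun_measurable mD (fun p Dp => Dp.2)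
    (chart_continuous_fst cf)).
have m2 : measurable_fun (cell D) (fun p => (planar f p).2 : measurableTypeR R).
  exact: planar_snd_measurable.
have := measurable_fun_pair ((measurable_restrictT _ mD).1 m1)
  ((measurable_restrictT _ mD).1 m2) measurableT mB.
rewrite setTI => /(measurableI _ _ mD); congr measurable.
by apply/seteqP; split => p [Dp]; rewrite /preimage /= /patch (mem_set Dp);
  split.
Qed.

End cell.

(** * Area preservation *)

Section pieces.
Variable R : realType.

(** The inverse of a matrix of determinant 1 has the same entries up to sign and place, so
    [M <= 2 * m * N]. The error is then at most [(1 - K^-1) * N], and [N <= r + (1 - K^-1) * N]
    gives [N <= K * r]. *)
Lemma linear_expansion_bound (K m e a b c d u v k1 k2 r : R) :
  0 < K -> 0 <= m -> 0 <= e -> a * d - b * c = 1 ->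
  `|a| <= m -> `|b| <= m -> `|c| <= m -> `|d| <= m ->
  6 * m * e <= 1 - K^-1 ->
  `|k1 - (a * u + b * v)| <= 3 * e * Num.max `|u| `|v| ->
  `|k2 - (c * u + d * v)| <= 3 * e * Num.max `|u| `|v| ->
  `|k1| <= r -> `|k2| <= r ->
  `|a * u + b * v| <= K * r /\ `|c * u + d * v| <= K * r.
Proof.
move=> K0 m0 e0 det am bm cm dm me.
set X := a * u + b * v; set Y := c * u + d * v; set M := Num.max `|u| `|v|.
move=> h1 h2 k1r k2r; set N := Num.max `|X| `|Y|.
have XN : `|X| <= N by rewrite le_max lexx.
have YN : `|Y| <= N by rewrite le_max lexx orbT.
have N0 : 0 <= N by exact: le_trans XN.
have uE : u = d * X + (- b) * Y.
  by rewrite /X /Y -[LHS]mul1r -det; ring.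
have vE : v = (- c) * X + a * Y.
  by rewrite /X /Y -[LHS]mul1r -det; ring.
have MN : M <= 2 * m * N.
  rewrite ge_max; apply/andP; split.
    rewrite uE (le_trans (linear_form_le _ _ _ _))// normrN ler_wpM2r//; lra.
  rewrite vE (le_trans (linear_form_le _ _ _ _))// normrN ler_wpM2r//; lra.
have eM : 3 * e * M <= (1 - K^-1) * N.
  apply: (@le_trans _ _ (3 * e * (2 * m * N))).
    by apply: ler_wpM2l => //; apply: mulr_ge0.
  rewrite (_ : 3 * e * (2 * m * N) = 6 * m * e * N); last by ring.
  exact: ler_wpM2r.
have NK : N <= K * r.
  have : N <= r + (1 - K^-1) * N.
    rewrite ge_max; apply/andP; split.
      by have := ler_normB k1 (k1 - X); rewrite opprB addrC subrK; lra.
    by have := ler_normB k2 (k2 - Y); rewrite opprB addrC subrK; lra.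
  rewrite mulrBl mul1r => ?.
  by rewrite -ler_pdivrMl//; lra.
by split; exact: le_trans NK.
Qed.

(** Applied to the images of pieces, whose own measurability is not established; the closure is
    always Borel. *)
Definition closure2 (A : set (plane R)) : set (plane R) :=
  [set w | forall e : R, 0 < e ->
    exists2 p, A p & `|p.1 - w.1| < e /\ `|p.2 - w.2| < e].

Lemma closure2_sub A : A `<=` closure2 A.
Proof. by move=> w Aw e e0; exists w => //; rewrite !subrr normr0. Qed.

Lemma closure2_measurable A : measurable (closure2 A).
Proof.
rewrite -[closure2 A]setCK; apply: measurableC.
apply: open_plane_measurable => w nAw.
have [e [e0 eA]] : exists e : R, 0 < e /\
    forall p, A p -> ~ (`|p.1 - w.1| < e /\ `|p.2 - w.2| < e).
  apply: contra_notP nAw => h e e0; apply: contra_notP h => h.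
  by exists e; split => // p Ap pw; apply: h; exists p.
have e2 : 0 < e / 2 by rewrite divr_gt0.
exists (e / 2) => // q q1 q2 /(_ _ e2) [p Ap [p1 p2]].
apply: (eA p Ap); split.
  by rewrite -(subrK q.1 p.1) -addrA (le_lt_trans (ler_normD _ _))//; lra.
by rewrite -(subrK q.2 p.2) -addrA (le_lt_trans (ler_normD _ _))//; lra.
Qed.

Variables (D : set (cylinder R)) (f : cylinder R -> cylinder R).
Variables a b c d : cylinder R -> R.
Hypothesis fD : chart_differentiable D f a b c d.
Hypothesis det1 : forall z, D z -> a z * d z - b z * c z = 1.
Hypothesis inv_cont : chart_inverse_continuous D f.

Local Notation F := (planar f).

Lemma planar_inv_cont p : cell D p -> forall e : R, 0 < e ->
  exists2 r : R, 0 < r & forall q, cell D q ->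
    `|(F q).1 - (F p).1| < r -> `|(F q).2 - (F p).2| < r ->
    `|q.1 - p.1| < e /\ `|q.2 - p.2| < e.
Proof.
move=> [/andP[p0 p1] Dp] e e0.
(* The last two bounds keep [p.2 + k2] in the open unit interval, where it must coincide with
   [q.2]. *)
have [|r r0 rP] := inv_cont Dp (e := Num.min e (Num.min p.2 (1 - p.2))).
  by rewrite !lt_min e0 p0 subr_gt0.
exists r => // q [/andP[q0 q1] Dq] h1 h2.
have [|k1 [k2 []]] := rP _ _ h1 h2 _ Dq.
  by rewrite -[f (wrap q)]coordK -[f (wrap p)]coordK -wrapB.
rewrite -wrapD /wrap => -[q1E q2E]; rewrite !lt_min => /and3P[k1e _ _].
move=> /and3P[k2e]; rewrite !ltr_norml => /andP[? _] /andP[_ ?].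
have {}q2E : q.2 = p.2 + k2.
  by apply: (ang_inj q2E); rewrite ltr_norml; apply/andP; split; lra.
have k1E : (q.1 : R) - p.1 = k1 by rewrite q1E /=; ring.
have k2E : (q.2 : R) - p.2 = k2 by rewrite q2E; ring.
by split; rewrite ?k1E ?k2E -ltr_norml.
Qed.

Lemma dist_perturb (x y x' y' r e : R) : `|x' - x| < e -> `|y' - y| < e ->
  `|x - y| <= r -> `|x' - y'| <= r + 2 * e.
Proof. by rewrite !ltr_norml !ler_norml; lra. Qed.

Lemma dist_dist (x y x' y' e : R) : `|x' - x| < e -> `|y' - y| < e ->
  `|(x - y) - (x' - y')| <= 2 * e.
Proof. by rewrite !ltr_norml !ler_norml; lra. Qed.

(** A point whose image is a limit of images of points of [E] is itself a limit of those points, by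
    continuity of the inverse; the inequalities pass to the limit. *)
Lemma near_isometry_closure (K : R) (E : set (plane R)) : 0 < K ->
  E `<=` cell D -> near_isometry K E F ->
  near_isometry K (cell D `&` F @^-1` closure2 (F @` E)) F.
Proof.
move=> K0 ED [a' [b' [c' [d' [det iso]]]]].
exists a', b', c', d'; split => // p q r [Dp Ep] [Dq Eq] h1 h2.
(* Moving both points and both images by less than [e] costs at most [2 * B * e]. *)
set B := `|a'| + `|b'| + `|c'| + `|d'| + K.
have B0 : 0 < B by rewrite /B ltr_wpDl// !addr_ge0.
have approx s (e : R) : 0 < e -> cell D s -> closure2 (F @` E) (F s) ->
    exists2 s', E s' & [/\ `|(F s').1 - (F s).1| < e, `|(F s').2 - (F s).2| < e,
      `|s'.1 - s.1| < e & `|s'.2 - s.2| < e].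
  move=> e0 Ds Es; have [r0 r00 r0P] := planar_inv_cont Ds e0.
  have [|_ [s' Es' <-]] := Es (Num.min e r0); first by rewrite lt_min e0.
  rewrite !lt_min => -[/andP[s1 s2] /andP[s3 s4]].
  by exists s' => //; have [] := r0P _ (ED _ Es') s2 s4.
have main (e : R) : 0 < e ->
    `|a' * (p.1 - q.1) + b' * (p.2 - q.2)| <= K * r + 2 * B * e /\
    `|c' * (p.1 - q.1) + d' * (p.2 - q.2)| <= K * r + 2 * B * e.
  move=> e0; have [p' Ep' [Fp1 Fp2 p1 p2]] := approx p e e0 Dp Ep.
  have [q' Eq' [Fq1 Fq2 q1 q2]] := approx q e e0 Dq Eq.
  have [||i1 i2] := iso p' q' (r + 2 * e) Ep' Eq'.
  - exact: (dist_perturb Fp1 Fq1 h1).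
  - exact: (dist_perturb Fp2 Fq2 h2).
  have step (x y : R) : `|x| + `|y| + K <= B ->
      `|x * (p'.1 - q'.1) + y * (p'.2 - q'.2)| <= K * (r + 2 * e) ->
      `|x * (p.1 - q.1) + y * (p.2 - q.2)| <= K * r + 2 * B * e.
    move=> xyB.
    set u : R := (p.1 - q.1) - (p'.1 - q'.1).
    set v : R := (p.2 - q.2) - (p'.2 - q'.2).
    have ue : `|u| <= 2 * e by exact: (dist_dist p1 q1).
    have ve : `|v| <= 2 * e by exact: (dist_dist p2 q2).
    have uv : Num.max `|u| `|v| <= 2 * e by rewrite ge_max ue.
    have := linear_form_le x y u v => h3 h4.
    rewrite (_ : x * (p.1 - q.1) + y * (p.2 - q.2) =
      (x * (p'.1 - q'.1) + y * (p'.2 - q'.2)) + (x * u + y * v)); last first.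
      by rewrite /u /v; ring.
    rewrite (le_trans (ler_normD _ _))//.
    have : (`|x| + `|y|) * Num.max `|u| `|v| <= (`|x| + `|y|) * (2 * e).
      by apply: ler_wpM2l => //; apply: addr_ge0.
    nra.
  have := normr_ge0 a'; have := normr_ge0 b'.
  have := normr_ge0 c'; have := normr_ge0 d' => d1 c1 b1 a1.
  by split; apply: step => //; rewrite /B; lra.
have B2 : 0 < 2 * B by rewrite mulr_gt0.
split; apply/ler_addgt0Pr => e e0; have [h3 h4] := main _ (divr_gt0 e0 B2);
  by rewrite [2 * B * _]mulrC divfK ?gt_eqF in h3 h4.
Qed.

(* Each piece has size [2^-n], on it the derivative has entries bounded by [m]
   and constant up to [e m], and the first order expansion at each of its points
   is accurate up to [e m] on the whole piece. *)
Variable e : nat -> R.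
Hypothesis e_gt0 : forall m, 0 < e m.

(** Level, bound on the entries, rounded derivative and dyadic square; the type is countable, so the
    pieces can be enumerated. *)
Definition cell_index : Type := nat * nat * (int * int * (int * int)) * (int * int).

Definition derivative_index m z : int * int * (int * int) :=
  (Num.floor (a z / e m), Num.floor (b z / e m),
  (Num.floor (c z / e m), Num.floor (d z / e m))).

Definition piece (i : cell_index) : set (plane R) :=
  let: (n, m, q, k) := i in
  [set p | [/\ cell D p, dyadic_index n p = k,
    derivative_index m (wrap p) = q,
    [/\ `|a (wrap p)| <= m%:R, `|b (wrap p)| <= m%:R,
        `|c (wrap p)| <= m%:R & `|d (wrap p)| <= m%:R] &
    forall u v, `|u| < 2 ^- n -> `|v| < 2 ^- n -> D (wrap p + wrap (u, v)) ->
      exists k1 k2 : R,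
      [/\ f (wrap p + wrap (u, v)) = f (wrap p) + wrap (k1, k2),
          `|k1 - (a (wrap p) * u + b (wrap p) * v)| <= e m * Num.max `|u| `|v|,
          `|k2 - (c (wrap p) * u + d (wrap p) * v)| <= e m * Num.max `|u| `|v| &
          `|k2| < 2^-1]]].

Lemma piece_sub i : piece i `<=` cell D.
Proof. by case: i => -[[n m] q] k p []. Qed.

(** The order of choice matters: [m] bounds the derivative at [p], it fixes the accuracy [e m],
    which fixes the radius [r] and then the level [n]. *)
Lemma piece_cover p : cell D p -> exists i, piece i p.
Proof.
move=> [p01 Dp]; set z := wrap p.
pose m := (Num.truncn (`|a z| + `|b z| + `|c z| + `|d z|)).+1.
have entries : [/\ `|a z| <= m%:R, `|b z| <= m%:R, `|c z| <= m%:R & `|d z| <= m%:R].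
  have : `|a z| + `|b z| + `|c z| + `|d z| <= m%:R by exact/ltW/truncnS_gt.
  have := normr_ge0 (a z); have := normr_ge0 (b z).
  have := normr_ge0 (c z); have := normr_ge0 (d z) => ? ? ? ? ?.
  by split; lra.
have half : 0 < 2^-1 :> R by rewrite invr_gt0.
have [r r0 rP] := chart_differentiable_small fD Dp (e_gt0 m) half.
pose n := (Num.truncn r^-1).+1.
have nr : 2 ^- n <= r.
  rewrite invf_ple ?posrE ?exprn_gt0// (le_trans (ltW (truncnS_gt _)))//.
  by rewrite -natrX ler_nat ltnW// ltn_expl.
exists (n, m, derivative_index m z, dyadic_index n p); split => // u v un vn Duv.
have [k1 [k2 [? ? ? _ ?]]] := rP u v (lt_le_trans un nr) (lt_le_trans vn nr) Duv.
by exists k1, k2.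
Qed.

Lemma floor_div_close (x y r : R) : 0 < r ->
  Num.floor (x / r) = Num.floor (y / r) -> `|x - y| <= r.
Proof.
move=> r0 xy; have := floor_itv (x / r); have := floor_itv (y / r).
rewrite xy intrD => /andP[h1 h2] /andP[h3 h4].
rewrite -(ler_pM2r (_ : 0 < r^-1)) ?invr_gt0// divff ?gt_eqF//.
rewrite -[X in _ * X]gtr0_norm ?invr_gt0// -normrM mulrBl.
by rewrite ler_norml; apply/andP; split; lra.
Qed.

(** The linear map is the derivative at one point [p0] of the piece, while the expansion is taken at
    [q]. *)
Lemma near_isometry_piece K i : 0 < K ->
  (forall m, 6 * m%:R * e m <= 1 - K^-1) -> near_isometry K (piece i) F.
Proof.
case: i => -[[n m] t] c0 K0 me.
have [|/set0P[p0 [[_ Dp0] _ p0t [a0 b0 c0' d0] _]]] :=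
    eqVneq (piece (n, m, t, c0)) set0.
  by move=> ->; exists 1, 0, 0, 1; split => //; rewrite mulr1 mulr0 subr0.
set z0 := wrap p0 in Dp0 p0t a0 b0 c0' d0.
exists (a z0), (b z0), (c z0), (d z0); split; first exact: det1.
move=> p q r [[p01 Dp] pc _ _ _] [[q01 Dq] qc qt _ qP] Fpq1 Fpq2.
have [e1 e2] : dyadic_index n p = dyadic_index n q by rewrite pc qc.
set u : R := p.1 - q.1; set v : R := p.2 - q.2.
have uvE : wrap q + wrap (u, v) = wrap p by rewrite -wrapB.
have un : `|u| < 2 ^- n by exact: dyadic_close.
have vn : `|v| < 2 ^- n by exact: dyadic_close.
have [|k1 [k2 []]] := qP u v un vn; first by rewrite uvE.
rewrite uvE => fpq h1 h2 k2s.
have em := e_gt0 m.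
have [da db dc dd] : [/\ `|a z0 - a (wrap q)| <= e m, `|b z0 - b (wrap q)| <= e m,
    `|c z0 - c (wrap q)| <= e m & `|d z0 - d (wrap q)| <= e m].
  move: p0t; rewrite -qt /derivative_index => -[ea eb ec ed].
  by split; exact: floor_div_close.
set M := Num.max _ _ in h1 h2.
have M0 : 0 <= M by rewrite le_max normr_ge0.
(* The factor 3 counts one [e m] for the expansion at [q] and one for each of the two entries
   replaced by those at [p0]. *)
have shift (x y x' y' k : R) : `|x - x'| <= e m -> `|y - y'| <= e m ->
    `|k - (x' * u + y' * v)| <= e m * M -> `|k - (x * u + y * v)| <= 3 * e m * M.
  move=> xx yy kM.
  rewrite (_ : k - _ = (k - (x' * u + y' * v)) - ((x - x') * u + (y - y') * v));
    last by ring.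
  rewrite (le_trans (ler_normB _ _))//.
  have := linear_form_le (x - x') (y - y') u v; rewrite -/M => h.
  have : (`|x - x'| + `|y - y'|) * M <= (e m + e m) * M.
    by apply: ler_wpM2r => //; exact: lerD.
  lra.
have k1r : `|k1| <= r.
  have -> : k1 = (F p).1 - (F q).1 by rewrite /planar /= fpq /=; ring.
  exact: Fpq1.
(* The angle coordinates differ by [k2] plus an integer [j]; as [k2] is below one half in absolute
   value, a nonzero [j] only increases the distance. *)
have k2r : `|k2| <= r.
  have : ang (F p).2 = ang ((F q).2 + k2).
    by rewrite angD /planar /= !ang_secK fpq.
  move=> /ang_eqP[j jE]; apply: le_trans Fpq2.
  have -> : (F p).2 - (F q).2 = k2 + j%:~R by rewrite jE; ring.
  have [->|j0] := eqVneq j 0; first by rewrite addr0.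
  have : 1 <= `|j%:~R| :> R by rewrite -intr_norm ler1z -gtz0_ge1 normr_gt0.
  have := ler_normB (k2 + j%:~R) k2; rewrite addrAC subrr add0r; lra.
apply: (linear_expansion_bound K0 _ _ (det1 Dp0) a0 b0 c0' d0 (me m)
  (shift _ _ _ _ _ da db h1) (shift _ _ _ _ _ dc dd h2) k1r k2r) => //.
exact: ltW.
Qed.

End pieces.

(** * The area inequality for symplectic maps *)

Section area_preserving.
Variable R : realType.
Local Notation mu := (@leb2 R).

Lemma planar_near_isometry_cover (D : set (cylinder R)) f a b c d :
  chart_differentiable D f a b c d ->
  (forall z, D z -> a z * d z - b z * c z = 1) ->
  chart_inverse_continuous D f ->
  forall K, 1 < K -> exists G : nat -> set (plane R),
    [/\ forall j, measurable (G j),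
        forall p, cell D p -> exists j, G j (planar f p) &
        forall j, near_isometry K (cell D `&` planar f @^-1` (G j)) (planar f)].
Proof.
move=> fD det1 inv_cont K K1; have K0 : 0 < K by exact: lt_trans K1.
have K'0 : 0 < 1 - K^-1 by rewrite subr_gt0 invf_lt1.
(* Chosen for [6 * m * e m <= 1 - K^-1]; the added 1 keeps the denominator positive at [m = 0]. *)
pose e (m : nat) := (1 - K^-1) / (6 * m%:R + 1).
have m1 m : 0 < 6 * m%:R + 1 :> R by rewrite ltr_wpDl// mulr_ge0.
have e0 m : 0 < e m by rewrite divr_gt0.
have me m : 6 * m%:R * e m <= 1 - K^-1.
  rewrite /e mulrCA ler_piMr ?(ltW K'0)// ler_pdivrMr// mul1r lerDl.
  exact: ler01.
pose P := piece D f a b c d e.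
pose G j := if unpickle j is Some i then closure2 (planar f @` P i) else set0.
exists G; split => [j|p Dp|j]; rewrite /G.
- by case: unpickle => // i; exact: closure2_measurable.
- have [i Pi] := piece_cover fD e0 Dp; exists (pickle i).
  by rewrite pickleK; apply: closure2_sub; exists p.
- case: unpickle => [i|]; last first.
    exists 1, 0, 0, 1; split; first by rewrite mulr1 mulr0 subr0.
    by move=> p q r [].
  apply: near_isometry_closure => //; first exact: piece_sub.
  exact: near_isometry_piece.
Qed.

Lemma planar_measure_preimage_le (D : set (cylinder R)) f a b c d (N : nat) :
  chart_differentiable D f a b c d ->
  (forall z, D z -> a z * d z - b z * c z = 1) ->
  chart_inverse_continuous D f ->
  measurable (cell D) -> (mu (cell D) < +oo)%E ->
  (forall z, D z -> `|(f z).1| < N%:R) ->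
  forall B, measurable B ->
    (mu (cell D `&` planar f @^-1` B) <= mu B)%E.
Proof.
move=> fD det1 inv_cont mD finD fN B mB.
have cf := chart_differentiable_continuous fD.
(* The successor makes the bound at least 1, so that it also covers the angle coordinate. *)
apply: (@near_isometry_preimage_le _ _ _ _ _ N.+1) => //.
- by move=> A mA; apply: planar_preimage_measurable.
- move=> p [_ Dp]; split.
    by rewrite (lt_le_trans (fN _ Dp))// ler_nat.
  have /andP[s0 s1] := ang_sec_itv (f (wrap p)).2.
  by rewrite ger0_norm// (lt_le_trans s1)// ler1n.
- exact: (planar_near_isometry_cover fD det1 inv_cont).
Qed.

End area_preserving.

(** * The annulus minus the curve *)

Section annulus.
Variable R : realType.
Local Notation mu := (@leb2 R).
Variables (Ia Ib : R) (c : R -> circle R).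
Hypothesis Iab : Ia < Ib.
Hypothesis c_C1 : C1_angle Ia Ib c.

Definition fundamental_box : set (plane R) := `[Ia, Ib]%classic `*` `[0%R, 1%R[%classic.

Lemma measurable_fundamental_box : measurable fundamental_box.
Proof. by apply: measurableX; exact: measurable_itv. Qed.

Lemma leb2_fundamental_box : mu fundamental_box = (Ib - Ia)%:E.
Proof.
rewrite /mu /leb2 product_measure1E//; try exact: measurable_itv.
have E1 := @lebesgue_measure_itv R `[Ia, Ib].
have E2 := @lebesgue_measure_itv R `[0, 1[.
rewrite /= lte_fin Iab in E1; rewrite /= lte_fin ltr01 sube0 in E2.
by rewrite -[RHS]mule1; congr (_ * _)%E; [exact: E1|exact: E2].
Qed.

Lemma C1_angle_continuous x : x \in `[Ia, Ib] -> forall e : R, 0 < e ->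
  exists2 r : R, 0 < r & forall h, `|h| < r -> x + h \in `[Ia, Ib] ->
    exists2 k : R, c (x + h) = c x + ang k & `|k| < e.
Proof.
move=> xI e e0; have [dc _ /(_ x xI 1 ltr01)] := c_C1.
move=> /nbhs_norm0P[r /= r0 rP].
have B0 : 0 < `|dc x| + 1 by rewrite ltr_wpDl.
exists (Num.min r (e / (`|dc x| + 1))).
  by rewrite lt_min r0 divr_gt0.
move=> h; rewrite lt_min => /andP[hr he] xhI; have [k ck kh] := rP h hr xhI.
exists k => //; rewrite ltr_pdivlMr// in he; apply: le_lt_trans he.
rewrite -[k](subrK (dc x * h)) (le_trans (ler_normD _ _))// normrM; lra.
Qed.

Local Notation D := (annulus Ia Ib `\` curve Ia Ib c).

(** The domain of integration in [liouville_integral]; it differs from [cell D] only by points of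
    angle 0. *)
Definition fundamental_domain : set (plane R) :=
  [set p | 0 <= p.2 < 1 /\ D (wrap p)].

Lemma fundamental_domainP p : fundamental_domain p <->
  fundamental_box p /\ p.2 <> ang_sec (c p.1).
Proof.
split=> [[p01 [/= pI pc]]|[[/= pI p01] pc]].
  split; first by split; rewrite //= in_itv.
  by move=> pE; apply: pc; split => //=; rewrite pE ang_secK.
rewrite in_itv/= in p01; split => //; split => // -[_ /= pE]; apply: pc.
by apply/esym; exact: ang_sec_uniq.
Qed.

Lemma fundamental_domain_box : fundamental_domain `<=` fundamental_box.
Proof. by move=> p /fundamental_domainP[]. Qed.

Lemma cell_fundamental_domain :
  cell D = fundamental_domain `&` (setT `*` `]0%R, +oo[%classic).
Proof.
apply/seteqP; split => [p [/andP[p0 p1] Dp]|p [[/andP[p0 p1] Dp] [_ /=]]].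
  split; first by split => //; rewrite ltW.
  by split; rewrite //= in_itv/= andbT.
by rewrite in_itv/= andbT => {}p0; split => //; rewrite p0.
Qed.

(** The curve is closed, so this set is relatively open in the box: a nearby point on the curve
    would force an integer to be too close to [p.2 - t]. *)
Lemma measurable_fundamental_domain : measurable fundamental_domain.
Proof.
apply: (relatively_open_measurable measurable_fundamental_box).
  exact: fundamental_domain_box.
move=> p /fundamental_domainP[[/= pI p01] pc].
rewrite in_itv/= in p01.
set t := ang_sec (c p.1) in pc.
have /andP[t0 t1] : 0 <= t < 1 := ang_sec_itv _.
have /andP[p0 p1] := p01.
(* [Num.min s (1 - s)] is the distance on the circle from [p] to the point of the curve with the
   same action; half is left for moving [p], half for moving along the curve. *)
pose s : R := `|p.2 - t|; pose m := Num.min s (1 - s) / 2.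
have s0 : 0 < s by rewrite normr_gt0 subr_eq0; apply/eqP.
have s1 : s < 1 by rewrite ltr_norml; lra.
have m0 : 0 < m by rewrite divr_gt0// lt_min s0 subr_gt0.
have [ms m1s] : 2 * m <= s /\ 2 * m <= 1 - s.
  by rewrite mulrC /m divfK// !ge_min !lexx orbT.
have [r r0 rP] := C1_angle_continuous pI m0.
exists (Num.min m r); first by rewrite lt_min m0.
move=> q [q1I q2I]; rewrite !lt_min => /andP[_ q1] /andP[q2 _].
apply/fundamental_domainP; split => //.
move=> q2E; have qE : (p.1 : R) + (q.1 - p.1) = q.1 by rewrite addrC subrK.
have [|k] := rP _ q1; first by rewrite qE; exact: q1I.
rewrite qE => cq kp.
have : ang q.2 = ang (t + k) by rewrite q2E ang_secK cq angD /t ang_secK.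
have := ler_normB (q.2 - p.2 + (p.2 - t)) (q.2 - p.2).
move=> _ /ang_eqP[j jE].
have jE' : j%:~R = (p.2 - t) + ((q.2 - p.2) - k) by rewrite jE; ring.
have small : `|(q.2 - p.2) - k| < 2 * m.
  by rewrite (le_lt_trans (ler_normB _ _))//; lra.
have j0 : j = 0.
  apply: (@intr_small R); rewrite jE' (le_lt_trans (ler_normD _ _))//.
  by rewrite -/s; lra.
move: jE'; rewrite j0 => /esym/eqP; rewrite addr_eq0 => /eqP sE.
by move: small ms; rewrite /s sE normrN; lra.
Qed.

Lemma measurable_cell_annulus : measurable (cell D).
Proof.
rewrite cell_fundamental_domain; apply: measurableI.
  exact: measurable_fundamental_domain.
by apply: measurableX => //; exact: measurable_itv.
Qed.

(** Each vertical section has at most two points, the angle 0 and the angle of the curve. *)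
Lemma leb2_box_minus_cell : mu (fundamental_box `\` cell D) = 0%E.
Proof.
have mZ : measurable (fundamental_box `\` cell D).
  apply: measurableD; first exact: measurable_fundamental_box.
  exact: measurable_cell_annulus.
rewrite /mu /leb2 /product_measure1; apply: integral0_eq => x _ /=.
apply: (@subset_measure0 _ _ _ lebesgue_measure _ [set 0; ang_sec (c x)]).
- exact: measurable_xsection.
- by apply: measurableU; exact: measurable_set1.
- move=> y; rewrite /xsection /= inE cell_fundamental_domain => -[Bxy nxy].
  have [->|y0] := eqVneq y 0; first by left.
  right; apply: contra_notP nxy => yc; split; first exact/fundamental_domainP.
  move: Bxy => [_ /=]; rewrite in_itv/= => /andP[y0' _].
  by split; rewrite //= in_itv/= andbT lt_def y0.
- by apply: countable_lebesgue_measure0; apply: finite_set_countable.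
Qed.

End annulus.

(** * Recurrence and drift *)

Section bounded_integral.
Context d (T : measurableType d) (R : realType) (mu : {measure set T -> \bar R}).

Lemma bounded_integrable (A : set T) (g : T -> R) (M : R) :
  measurable A -> (mu A < +oo)%E -> measurable_fun A g ->
  (forall x, A x -> `|g x| <= M) -> mu.-integrable A (EFin \o g).
Proof.
move=> mA finA mg gM; apply: measurable_bounded_integrable => //.
exists M; split; first exact: num_real.
by move=> K MK x Ax /=; rewrite (le_trans (gM _ Ax))// ltW.
Qed.

Lemma bounded_integral_le (A : set T) (g : T -> R) (M : R) :
  measurable A -> measurable_fun A g -> 0 <= M ->
  (forall x, A x -> `|g x| <= M) ->
  (`|\int[mu]_(x in A) (g x)%:E| <= M%:E * mu A)%E.
Proof.
move=> mA mg M0 gM.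
have mEg : measurable_fun A (EFin \o g) by exact/measurable_EFinP.
apply: (le_trans (le_abse_integral mu mA mEg)).
rewrite -(integral_cst mu mA); apply: ge0_le_integral => //; exact: measurableT_comp.
Qed.

End bounded_integral.

(** * Points with an infinite forward orbit *)

Section recurrence.
Variable R : realType.
Local Notation mu := (@leb2 R).
Variables (X : set (plane R)) (F : plane R -> plane R).
Hypothesis mX : measurable X.
Hypothesis finX : (mu X < +oo)%E.
Hypothesis mF : forall B, measurable B -> measurable (X `&` F @^-1` B).
Hypothesis muF : forall B, measurable B -> (mu (X `&` F @^-1` B) <= mu B)%E.

Definition pre (B : set (plane R)) := X `&` F @^-1` B.

Lemma iter_preP n B p : iter n pre B p <->
  (forall k, (k < n)%N -> X (iter k F p)) /\ B (iter n F p).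
Proof.
elim: n p => [|n ih] p; first by split=> [Bp|[]].
rewrite iterS /pre; split => [[Xp /ih[h Bp]]|[h Bp]].
  by split => [[|k] kn//|]; rewrite iterSr//; exact: h.
split; first exact: (h 0%N).
by apply/ih; split => [k kn|]; rewrite -iterSr//; exact: h.
Qed.

Lemma iter_pre_measurable n B : measurable B -> measurable (iter n pre B).
Proof. by move=> mB; elim: n => //= n ih; exact: mF. Qed.

Lemma iter_pre_measure0 n B : measurable B -> mu B = 0%E ->
  mu (iter n pre B) = 0%E.
Proof.
move=> mB B0; elim: n => //= n ih; apply/eqP; rewrite eq_le measure_ge0 andbT.
by rewrite -ih; apply: muF; exact: iter_pre_measurable.
Qed.

(** The points whose whole forward orbit stays in [X], that is, the largest subset of [X] that [F]
    maps into itself. *)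
Definition eternal := \bigcap_n iter n pre X.

Lemma eternal_measurable : measurable eternal.
Proof. by apply: bigcapT_measurable => n; exact: iter_pre_measurable. Qed.

Lemma eternal_sub : eternal `<=` X.
Proof. by move=> p /(_ 0%N I). Qed.

Lemma eternal_invariant p : eternal p -> eternal (F p).
Proof. by move=> Ep n _; have [] := Ep n.+1 I. Qed.

Lemma eternal_mass_fin : (mu eternal < +oo)%E.
Proof.
by apply: le_lt_trans finX; apply: le_measure; rewrite ?inE;
  [exact: eternal_measurable|exact: mX|exact: eternal_sub].
Qed.

Local Notation U := eternal.

Lemma eternal_preimage_measurable B : measurable B ->
  measurable (U `&` F @^-1` B).
Proof.
move=> mB; rewrite (_ : _ `&` _ = U `&` (X `&` F @^-1` B)).
  by apply: measurableI; [exact: eternal_measurable|exact: mF].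
apply/seteqP; split => [p [Up Bp]|p [Up [_ Bp]]] //.
by split => //; split => //; exact: eternal_sub.
Qed.

(* [F] maps [U] into itself without increasing the measure of preimages; since
   the total mass is finite, it preserves it. *)
Lemma eternal_measure_preserving B : measurable B ->
  mu (U `&` F @^-1` B) = mu (U `&` B).
Proof.
have mU := eternal_measurable.
have le C : measurable C -> (mu (U `&` F @^-1` C) <= mu (U `&` C))%E.
  move=> mC; apply: le_trans (muF (measurableI _ _ mU mC)).
  apply: le_measure; rewrite ?inE.
  - exact: eternal_preimage_measurable.
  - by apply: mF; exact: measurableI.
  - move=> p [Up Cp]; split; first exact: eternal_sub.
    by split => //; exact: eternal_invariant.
have fin C : measurable C -> mu (U `&` C) \is a fin_num.
  move=> mC; rewrite ge0_fin_numE//; apply: le_lt_trans eternal_mass_fin.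
  by apply: le_measure; rewrite ?inE//; exact: measurableI.
have fin' C : measurable C -> mu (U `&` F @^-1` C) \is a fin_num.
  by move=> mC; rewrite ge0_fin_numE// (le_lt_trans (le _ mC))// ltey_eq fin.
move=> mB; have mB' := measurableC mB.
apply/eqP; rewrite eq_le le//=.
have : (mu (U `&` B) + mu (U `&` ~` B) =
        mu (U `&` F @^-1` B) + mu (U `&` F @^-1` (~` B)))%E.
  rewrite -!measureU//.
  - by congr (mu _); rewrite -!setIUr preimage_setC !setUv.
  - exact: eternal_preimage_measurable.
  - exact: eternal_preimage_measurable.
  - by apply/seteqP; split => // p [[_ Bp] [_ /= nBp]]; exact: nBp.
  - exact: measurableI.
  - exact: measurableI.
  - by apply/seteqP; split => // p [[_ Bp] [_ /= nBp]]; exact: nBp.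
move: (le _ mB').
rewrite -(fineK (fin _ mB)) -(fineK (fin _ mB')) -(fineK (fin' _ mB)).
rewrite -(fineK (fin' _ mB')) -!EFinD !lee_fin => h [e]; lra.
Qed.

Lemma eternal_integral_invariant (g : plane R -> R) :
  measurable_fun [set: plane R] g -> (exists M, forall p, U p -> `|g p| <= M) ->
  (\int[mu]_(p in U) (g (F p))%:E = \int[mu]_(p in U) (g p)%:E)%E.
Proof.
move=> mg [M gM]; have mU := eternal_measurable.
(* Extended by the identity off [U], the map preserves the area of the whole plane and the preimage
   of [U] is [U], so the change of variables applies. *)
pose T p := if p \in U then F p else p.
have TU : T @^-1` U = U.
  apply/seteqP; split => p; rewrite /T /preimage /=.
    by case: ifPn => [/set_mem//|].
  by move=> Up; rewrite mem_set//; exact: eternal_invariant.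
have preT B : T @^-1` B = (U `&` F @^-1` B) `|` (~` U `&` B).
  apply/seteqP; split => p; rewrite /T /preimage /=.
    case: ifPn => [/set_mem|/negP nU]; first by left.
    by right; split => // Up; exact/nU/mem_set.
  by case=> -[Up Bp]; [rewrite mem_set|rewrite memNset].
have mT : measurable_fun [set: plane R] T.
  move=> _ B mB; rewrite setTI preT; apply: measurableU.
    exact: eternal_preimage_measurable.
  by apply: measurableI => //; exact: measurableC.
have [nu nuE] := pushforward_measure_exists mu mT.
have nu_mu B : measurable B -> nu B = mu B.
  move=> mB; rewrite nuE preT measureU//.
  - transitivity (mu (U `&` B) + mu (~` U `&` B))%E.
      by congr (_ + _)%E; exact: eternal_measure_preserving.
    rewrite -measureU//.
    + by rewrite -setIUl setUv setTI.
    + exact: measurableI.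
    + by apply: measurableI => //; exact: measurableC.
    + by apply/seteqP; split => // p [[Up _] [nUp _]].
  - exact: eternal_preimage_measurable.
  - by apply: measurableI => //; exact: measurableC.
  - by apply/seteqP; split => // p [[Up _] [nUp _]].
have -> : (\int[mu]_(p in U) (g p)%:E = \int[nu]_(p in U) (g p)%:E)%E.
  by apply: eq_measure_integral => A mA _; rewrite nu_mu.
rewrite (_ : (nu : set _ -> _) = pushforward mu T); last first.
  by apply/funext => A; rewrite nuE.
rewrite (@integral_pushforward _ _ _ _ _ _ mT mu U (EFin \o g))//.
- rewrite TU; apply: eq_integral => p /[!inE] Up.
  by rewrite /= /T mem_set.
- exact/measurable_EFinP.
- rewrite TU; apply: (bounded_integrable (M := M)) => //.
  + exact: eternal_mass_fin.
  + exact/measurable_funTS/measurableT_comp.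
  + move=> p Up; rewrite /comp /T mem_set//; apply: gM; exact: eternal_invariant.
Qed.

End recurrence.

(** * Mean displacement when no orbit drifts *)

Section drift.
Variable R : realType.
Local Notation mu := (@leb2 R).
Variables (Ia Ib : R) (X : set (plane R)) (F : plane R -> plane R).
Hypothesis Iab : Ia < Ib.
Hypothesis mX : measurable X.
Hypothesis X_box : X `<=` fundamental_box Ia Ib.
Hypothesis X_full : mu (fundamental_box Ia Ib `\` X) = 0%E.
Hypothesis F_sec : forall p, 0 <= (F p).2 < 1.
Hypothesis mF : forall B, measurable B -> measurable (X `&` F @^-1` B).
Hypothesis muF : forall B, measurable B -> (mu (X `&` F @^-1` B) <= mu B)%E.
Variable C : R.
Hypothesis C0 : 0 < C.
Hypothesis no_drift : forall n p, (forall k, (k < n)%N -> X (iter k F p)) ->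
  `|(iter n F p).1 - p.1| <= C.

Local Notation U := (eternal X F).

Lemma leb2_full_le : (mu X <= (Ib - Ia)%:E)%E.
Proof.
rewrite -(leb2_fundamental_box Iab); apply: le_measure; rewrite ?inE//.
exact: measurable_fundamental_box.
Qed.

Let finX : (mu X < +oo)%E.
Proof. exact: le_lt_trans leb2_full_le (ltry _). Qed.

(** An orbit that starts at distance more than [C] from both boundaries is still in the box when it
    first leaves [X], so it leaves through the null set of the box outside [X]. *)
Lemma not_eternal_sub : X `\` U `<=`
  (fundamental_box Ia (Ia + C) `|` fundamental_box (Ib - C) Ib) `|`
  \bigcup_n iter n (pre X F) (fundamental_box Ia Ib `\` X).
Proof.
move=> p [Xp nUp]; have [/= pI p01] := X_box Xp.
have [lo|lo] := leP p.1 (Ia + C).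
  by left; left; split => //=; move: pI; rewrite !in_itv/= lo => /andP[-> _].
have [hi|hi] := leP (Ib - C) p.1.
  by left; right; split => //=; move: pI; rewrite !in_itv/= hi => /andP[_ ->].
(* The first exit happens at time [n.+1]; [no_drift] still applies then, as it constrains only the
   earlier points. *)
right; have [n [Xn nXn]] : exists n, iter n (pre X F) X p /\
    ~ iter n.+1 (pre X F) X p.
  apply: contra_notP nUp => h; elim=> [//|n ih] _.
  by apply: contra_notP h => nXn; exists n; split => //; exact: ih.
have orb k : (k < n.+1)%N -> X (iter k F p).
  by move=> kn; have /iter_preP[h1 h2] := Xn; move: kn; rewrite ltnS leq_eqVlt
    => /predU1P[->//|]; exact: h1.
exists n.+1 => //; apply/iter_preP; split => //; split; last first.
  by move=> Xw; apply: nXn; apply/iter_preP.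
have := no_drift orb; rewrite iterS => d; split => /=; rewrite in_itv/= ?F_sec//.
by move: d; rewrite ler_norml => /andP[? ?]; apply/andP; split; lra.
Qed.

(** Two strips of width [C], and countably many iterated preimages of a null set, which are null. *)
Lemma leb2_not_eternal : (mu (X `\` U) <= (2 * C)%:E)%E.
Proof.
have mZ : measurable (fundamental_box Ia Ib `\` X).
  by apply: measurableD => //; exact: measurable_fundamental_box.
have sub := not_eternal_sub; set N := \bigcup_n _ in sub.
have mN : measurable N.
  by apply: bigcupT_measurable => n; exact: iter_pre_measurable.
have N0 : mu N = 0%E.
  apply/eqP; rewrite eq_le measure_ge0 andbT.
  apply: le_trans (generalized_Boole_inequality mu _ mN) _.
    by move=> n; exact: iter_pre_measurable.
  rewrite eseries0// => n _ _; exact: iter_pre_measure0.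
have m1 := measurable_fundamental_box Ia (Ia + C).
have m2 := measurable_fundamental_box (Ib - C) Ib.
have mS := measurableU _ _ m1 m2; set S := _ `|` _ in mS sub.
have leS : (mu S <= (2 * C)%:E)%E.
  apply: le_trans (measureU2 mu m1 m2) _.
  apply: (@le_trans _ _ (C%:E + C%:E)%E); last by rewrite -EFinD lee_fin; lra.
  apply: leeD.
    by rewrite [leLHS](leb2_fundamental_box (_ : Ia < Ia + C)) ?ltrDl// lee_fin; lra.
  by rewrite [leLHS](leb2_fundamental_box (_ : Ib - C < Ib)) ?gtrBl// lee_fin; lra.
have le1 : (mu (X `\` U) <= mu (S `|` N))%E.
  apply: le_measure; rewrite ?inE//; last exact: measurableU.
  by apply: measurableD => //; exact: eternal_measurable.
have le2 : (mu (S `|` N) <= mu S + mu N)%E by exact: measureU2.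
by rewrite N0 adde0 in le2; exact: le_trans le1 (le_trans le2 leS).
Qed.

(** The action is bounded on [U], and its integral over [U] is invariant under [F]. *)
Lemma eternal_displacement : measurable_fun X (fun p => (F p).1 : R) ->
  (\int[mu]_(p in U) ((F p).1 - p.1)%:E = 0)%E.
Proof.
move=> mF1; have mU := eternal_measurable mX mF.
have finU : (mu U < +oo)%E by exact: (eternal_mass_fin mX).
pose K := `|Ia| + `|Ib|.
have fstK p : U p -> `|p.1 : R| <= K.
  move=> /eternal_sub/X_box[/= + _]; rewrite in_itv/= => /andP[h1 h2].
  have := ler_norm Ib; have := ler_norm (- Ia); rewrite normrN.
  have := normr_ge0 Ia; have := normr_ge0 Ib.
  by rewrite /K ler_norml => ? ? ? ?; apply/andP; split; lra.
have mfst : measurable_fun [set: plane R] (fun p => p.1 : R) by exact: measurable_fst.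
rewrite integralB_EFin//.
- rewrite (eternal_integral_invariant mX finX mF muF mfst); last by exists K.
  rewrite subee// integrable_fin_num//.
  by apply: (bounded_integrable (M := K)) => //; exact: measurable_funTS.
- apply: (bounded_integrable (M := K)) => //.
    apply: measurable_funS mF1 => //; exact: eternal_sub.
  by move=> p Up; apply: fstK; exact: eternal_invariant.
- by apply: (bounded_integrable (M := K)) => //; exact: measurable_funTS.
Qed.

(** On [U], [G] differs by at most [C1 * eps] from the displacement divided by [eps], which has zero
    mean; off [U], [G] is at most [M] on an area of at most [2 * C]. *)
Lemma drift_integral_le (G : plane R -> R) (M C1 eps : R) :
  measurable_fun X (fun p => (F p).1 : R) -> measurable_fun X G ->
  0 <= M -> 0 <= C1 -> 0 < eps -> (forall p, X p -> `|G p| <= M) ->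
  (forall p, X p -> `|(F p).1 - p.1 - eps * G p| <= C1 * eps ^+ 2) ->
  (`|\int[mu]_(p in X) (G p)%:E| <= (C1 * eps * (Ib - Ia) + M * (2 * C))%:E)%E.
Proof.
move=> mF1 mG M0 C10 eps0 GM Gapprox.
have mU := eternal_measurable mX mF.
have finU : (mu U < +oo)%E by exact: (eternal_mass_fin mX).
have UX : U `<=` X by exact: eternal_sub.
have mXU : measurable (X `\` U) by exact: measurableD.
have XE : X = U `|` (X `\` U) by rewrite setDUK.
rewrite [X in (\int[_]_(_ in X) _)%E]XE integral_setU//; last 2 first.
- by rewrite -XE; exact/measurable_EFinP.
- by apply/disj_setPS => p [Up [_ nUp]].
rewrite EFinD; apply: le_trans (lee_abs_add _ _) _; apply: leeD; last first.
  apply: le_trans (bounded_integral_le mu mXU _ M0 _) _.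
  - by apply: measurable_funS mG.
  - by move=> p [Xp _]; exact: GM.
  - by rewrite EFinM lee_wpmul2l ?lee_fin// leb2_not_eternal.
pose q p := ((F p).1 - p.1) / eps.
have mq : measurable_fun U q.
  apply: measurable_funM => //; apply: measurable_funB.
    by apply: measurable_funS mF1.
  apply: measurable_funTS.
  exact: (measurable_fst : measurable_fun _ (fun p : plane R => p.1 : R)).
have mGU : measurable_fun U G by exact: measurable_funS mG.
have GqE p : G p = q p - (q p - G p) by rewrite opprB addrC subrK.
have small p : U p -> `|q p - G p| <= C1 * eps.
  move=> Up; have := Gapprox _ (UX _ Up).
  have -> : (F p).1 - p.1 - eps * G p = eps * (q p - G p).
    by rewrite /q mulrBr mulrCA divff ?gt_eqF// mulr1.
  by rewrite normrM gtr0_norm// expr2 mulrA [_ * eps]mulrC ler_pM2l.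
have mqG : measurable_fun U (fun p => q p - G p) by exact: measurable_funB.
have C1eps : 0 <= C1 * eps by rewrite mulr_ge0// ltW.
have intqG : mu.-integrable U (EFin \o (fun p => q p - G p)).
  exact: (bounded_integrable mU finU mqG small).
have qM p : U p -> `|q p| <= C1 * eps + M.
  move=> Up; rewrite -[q p](subrK (G p)) (le_trans (ler_normD _ _))//.
  by apply: lerD; [exact: small|exact/GM/UX].
have intq : mu.-integrable U (EFin \o q) by exact: (bounded_integrable mU finU mq qM).
have q0 : (\int[mu]_(p in U) (q p)%:E = 0)%E.
  have qE p : (q p)%:E = (eps^-1%:E * ((F p).1 - p.1)%:E)%E.
    by rewrite -EFinM mulrC.
  under eq_integral do rewrite qE.
  rewrite integralZl//; first by rewrite eternal_displacement// mule0.
  have -> : (fun p => ((F p).1 - p.1)%:E) = EFin \o (fun p => eps * q p).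
    by apply/funext => p /=; rewrite /q mulrCA divff ?gt_eqF// mulr1.
  have : mu.-integrable U (fun p => eps%:E * (EFin \o q) p)%E by exact: integrableZl.
  by congr (integrable _ _ _).
have -> : (\int[mu]_(p in U) (G p)%:E =
    \int[mu]_(p in U) ((q p)%:E - (q p - G p)%:E))%E.
  by apply: eq_integral => p _; rewrite -EFinB -GqE.
rewrite (integralB_EFin mU intq intqG) q0 add0e abseN.
apply: le_trans (bounded_integral_le mu mU mqG C1eps small) _.
rewrite [leRHS]EFinM lee_wpmul2l ?lee_fin//; apply: le_trans leb2_full_le.
by apply: le_measure; rewrite ?inE.
Qed.

End drift.

(** * Consequences of the diffeomorphism and symplecticity assumptions *)

Section hypotheses.
Variable R : realType.
Implicit Types (D : set (cylinder R)) (f : cylinder R -> cylinder R).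

Lemma diffeo_inverse_continuous D f : diffeo_onto_image D f ->
  chart_inverse_continuous D f.
Proof.
move=> [Df [g [Dg [_ /C1_map_differentiable gC gK]]]] z Dz e e0.
have fDz : (f @` D) (f z) by exists z.
have [r r0 rP] := chart_differentiable_continuous gC fDz e0.
exists r => // u v ur vr z' Dz' fz'.
have [|k1 [k2 [gE k1e k2e]]] := rP u v ur vr; first by rewrite -fz'; exists z'.
by exists k1, k2; split => //; rewrite -[LHS]gK// -[z in RHS]gK// fz' gE.
Qed.

(** The area form evaluated on the images of the two basis vectors is the determinant. *)
Lemma symplectic_det D f : symplectic D f -> exists2 Df, C1_map D f Df &
  forall z, D z -> Df z 0 0 * Df z 1 1 - Df z 0 1 * Df z 1 0 = 1.
Proof.
move=> [Df fC area]; exists Df => // z Dz.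
have := area z Dz (vec 1 0) (vec 0 1).
rewrite /area_form !mulmx_vecE !mxE /= !(mulr0, mulr1, addr0, add0r, subr0) => <-.
by rewrite [Df z 1 0 * _]mulrC.
Qed.

End hypotheses.

Theorem theorem5p10 (R : realType) (Ia Ib : R) (hI : Ia < Ib)
    (c : R -> circle R) (hc : C1_angle Ia Ib c)
    (D : set (cylinder R)) (hD : D = annulus Ia Ib `\` curve Ia Ib c)
    (eps1 : R) (heps1 : 0 < eps1)
    (sigma : R -> cylinder R -> cylinder R)
    (hdiffeo : forall eps, 0 <= eps < eps1 -> diffeo_onto_image D (sigma eps))
    (hsymp : forall eps, 0 <= eps < eps1 -> symplectic D (sigma eps))
    (Delta : R -> R)
    (S dIS dthS : cylinder R -> R)
    (hS : C1_fun (base_rotation Delta @` D) S dIS dthS)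
    (M : R) (hM : 0 < M)
    (hSM : forall w, (base_rotation Delta @` D) w ->
       [/\ `|S w| <= M, `|dIS w| <= M & `|dthS w| <= M])
    (C0 : R) (hC0 : 0 < C0)
    (hsigma : forall eps z, 0 <= eps < eps1 -> D z ->
       exists2 r : 'cV[R]_2,
         sigma eps z =
           base_rotation Delta z
           + cov (eps *: vec (- dthS (base_rotation Delta z)) (dIS (base_rotation Delta z)))
           + cov r
         & `|r| <= C0 * eps ^+ 2)
    (hint : liouville_integral D (fun z => - dthS (base_rotation Delta z)) <> 0%E) :
  exists eps0 C : R, [/\ 0 < eps0, 0 < C &
    forall eps, 0 < eps < eps0 ->
      exists (N : nat) (z : nat -> cylinder R),
        orbit_on D (sigma eps) N z /\ C < `|(z N).1 - (z 0%N).1| ].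
Proof.
pose mu := @leb2 R.
pose G (p : plane R) := - dthS (base_rotation Delta (wrap p)).
have mD : measurable (cell D) by rewrite hD; exact: measurable_cell_annulus.
have D_box : cell D `<=` fundamental_box Ia Ib.
  rewrite hD cell_fundamental_domain => p [+ _]; exact: fundamental_domain_box.
have D_full : mu (fundamental_box Ia Ib `\` cell D) = 0%E.
  by rewrite hD; exact: leb2_box_minus_cell.
have finD : (mu (cell D) < +oo)%E.
  by apply: le_lt_trans (ltry (Ib - Ia)); exact: leb2_full_le.
have rot_cont : chart_continuous D (base_rotation Delta).
  (* [Delta] is arbitrary, but [sigma 0] is the rotation on [D]. *)
  have e0 : 0 <= (0 : R) < eps1 by rewrite lexx.
  have sigma0 z : D z -> sigma 0 z = base_rotation Delta z.
    move=> Dz; have [r ->] := hsigma 0 z e0 Dz.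
    rewrite expr0n mulr0 normr_le0 => /eqP ->.
    by rewrite scale0r cov0 !addr0.
  move=> z Dz e e_gt0.
  have [Df [_ [_ [/C1_map_differentiable s0C _ _]]]] := hdiffeo 0 e0.
  have s0 := chart_differentiable_continuous s0C.
  have [r r0 rP] := s0 z Dz e e_gt0; exists r => // u v ur vr Dzuv.
  by have := rP u v ur vr Dzuv; rewrite !sigma0.
have G_cont : chart_continuous_fun D (fun z => - dthS (base_rotation Delta z)).
  have [_ _ dth_cont] := hS.
  have h := continuous_along_comp rot_cont dth_cont.
  move=> z Dz e e0; have [r r0 rP] := h z Dz e e0; exists r => // u v ur vr Dzuv.
  by rewrite -opprB opprK -normrN opprK addrC; exact: rP.
have GM p : D (wrap p) -> `|G p| <= M.
  move=> Dp; rewrite /G normrN.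
  by have [] := hSM (base_rotation Delta (wrap p)) ltac:(by exists (wrap p)).
have mG : measurable_fun (cell D) G.
  exact: (chart_continuous_fun_measurable mD (fun p Dp => Dp.2) G_cont).
(* The two domains of integration differ by a null set, and the integrand is bounded. *)
have intG : liouville_integral D (fun z => - dthS (base_rotation Delta z)) =
    (\int[mu]_(p in cell D) (G p)%:E)%E.
  rewrite /liouville_integral /=; set D0 := [set p | _].
  have mD0 : measurable (D0 : set (plane R)).
    by rewrite /D0 hD; exact: (measurable_fundamental_domain hc).
  have D0_box : (D0 : set (plane R)) `<=` fundamental_box Ia Ib.
    by rewrite /D0 hD; exact: fundamental_domain_box.
  have mG0 : measurable_fun (D0 : set (plane R)) G.
    exact: (chart_continuous_fun_measurable mD0 (fun p Dp => Dp.2) G_cont).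
  have finD0 : (mu D0 < +oo)%E.
    apply: le_lt_trans (ltry (Ib - Ia)); rewrite -(leb2_fundamental_box hI).
    by apply: le_measure; rewrite ?inE//; exact: measurable_fundamental_box.
  have iG0 : mu.-integrable D0 (EFin \o G).
    by apply: (bounded_integrable (M := M)) => // p [_ Dp]; exact: GM.
  rewrite -[LHS]/(\int[mu]_(p in D0) (EFin \o G) p)%E.
  rewrite (negligible_integral _ mD0 iG0 D_full); last first.
    by apply: measurableD => //; exact: measurable_fundamental_box.
  congr (integral _ _ _); apply/seteqP; split => p.
    by move=> [/D0_box Bp]; rewrite /setD /= not_andP => -[//|/contrapT].
  move=> cp; split; last by case.
  by have [/andP[/ltW p0 p1] Dp] := cp; split => //; rewrite p0.
move: hint; rewrite intG.
have : (\int[mu]_(p in cell D) (G p)%:E)%E \is a fin_num.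
  apply: integrable_fin_num => //.
  by apply: (bounded_integrable (M := M)) => // p [_ Dp]; exact: GM.
move=> /fineK; set J := fine _ => intJ; rewrite -intJ => J_neq0.
have J0 : 0 < `|J| by rewrite normr_gt0; apply/eqP => J0; apply: J_neq0; rewrite J0.
pose L := Ib - Ia; have L0 : 0 < L by rewrite subr_gt0.
(* This makes the contribution [M * (2 * C)] of the missing area equal to a quarter of the absolute
   value of [J]. *)
pose C := `|J| / (8 * M).
have C_gt0 : 0 < C by rewrite divr_gt0// mulr_gt0.
(* The second bound makes [C0 * eps * L] less than another quarter, so that the two terms together
   stay below the absolute value of [J]. *)
exists (Num.min eps1 (`|J| / (4 * (C0 * L)))), C; split => //.
  by rewrite lt_min heps1 divr_gt0// !mulr_gt0.
move=> eps /andP[eps0]; rewrite lt_min => /andP[eps_eps1].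
rewrite ltr_pdivlMr ?mulr_gt0// => epsJ.
have eps01 : 0 <= eps < eps1 by rewrite ltW.
apply: contrapT => no_orbit.
pose F := planar (sigma eps).
have [Df /C1_map_differentiable sD det1] := symplectic_det (hsymp eps eps01).
have s_cont := chart_differentiable_continuous sD.
have inv_cont := diffeo_inverse_continuous (hdiffeo eps eps01).
have F_approx p : D (wrap p) -> `|(F p).1 - p.1 - eps * G p| <= C0 * eps ^+ 2.
  move=> Dp; have [r sE rC] := hsigma eps (wrap p) eps01 Dp.
  apply: le_trans rC; apply: le_trans (coef_le_norm r 0).
  rewrite /F /planar /= sE /= !mxE /=.
  rewrite (_ : _ - p.1 - _ = r 0 0)//; rewrite /G /=; ring.
have mF := planar_preimage_measurable mD s_cont.
have mF1 : measurable_fun (cell D) (fun p => (F p).1 : R).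
  exact: (chart_continuous_fun_measurable mD (fun p Dp => Dp.2)
    (chart_continuous_fst s_cont)).
pose N := (Num.truncn (`|Ia| + `|Ib| + eps * M + C0 * eps ^+ 2)).+1.
have sN z : D z -> `|(sigma eps z).1| < N%:R.
  move=> Dz; rewrite -(coordK z) in Dz *.
  have := F_approx (coord z) Dz; rewrite -[(sigma eps _).1]/(F (coord z)).1.
  set x : R := (F _).1; set y : R := (coord z).1 => xyG.
  have yI : `|y| <= `|Ia| + `|Ib|.
    have : y \in `[Ia, Ib] by move: Dz; rewrite hD => -[].
    rewrite in_itv/= => /andP[h1 h2].
    have := ler_norm Ib; have := ler_norm (- Ia); rewrite normrN.
    have := normr_ge0 Ia; have := normr_ge0 Ib => ? ? ? ?.
    by rewrite ler_norml; apply/andP; split; lra.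
  have Gb : `|eps * G (coord z)| <= eps * M.
    by rewrite normrM gtr0_norm// ler_pM2l//; exact: GM.
  apply: (@le_lt_trans _ _ (`|Ia| + `|Ib| + eps * M + C0 * eps ^+ 2)).
    rewrite (_ : x = y + eps * G (coord z) + (x - y - eps * G (coord z)));
      last by ring.
    rewrite (le_trans (ler_normD _ _))//; apply: lerD => //.
    by rewrite (le_trans (ler_normD _ _))//; exact: lerD.
  exact: truncnS_gt.
have muF : forall B, measurable B -> (mu (cell D `&` F @^-1` B) <= mu B)%E.
  exact: (planar_measure_preimage_le sD det1 inv_cont mD finD sN).
have F_sec p : 0 <= (F p).2 < 1 by exact: ang_sec_itv.
(* A planar orbit projects by [wrap] to an orbit of [sigma eps] with the same actions, so a
   displacement above [C] would be the excluded orbit. *)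
have no_drift n p : (forall k, (k < n)%N -> cell D (iter k F p)) ->
    `|(iter n F p).1 - p.1| <= C.
  move=> orb; rewrite leNgt; apply/negP => far; apply: no_orbit.
  exists n, (fun k => wrap (iter k F p)); split => //= k kn; split.
    by have [] := orb k kn.
  by rewrite /F /planar coordK.
have := drift_integral_le hI mD D_box D_full F_sec mF muF C_gt0 no_drift mF1 mG
  (ltW hM) (ltW hC0) eps0 (fun p Dp => GM p Dp.2) (fun p Dp => F_approx p Dp.2).
rewrite -intJ lee_fin leNgt => /negP; apply.
have -> : M * (2 * C) = `|J| / 4 by rewrite /C; field; rewrite gt_eqF.
by rewrite -/L; move: epsJ; lra.
Qed.
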